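(* Let $A$ be an $m$-sectorial operator in a Hilbert space $\mathfrak{H}$ with semi-angle $\alpha\in[0,\pi/2)$ and vertex at $z=0$. Then there is a finite constant $N>0$ such that $$\left\|e^{-n(\mathbf{1}-e^{-tA/n})}-e^{-tA}\right\|\le\frac{N}{(\cos\alpha)^2\,n},\qquad t\ge0,\ n\in\mathbb{N}.$$
   Context: $\mathbf{1}$ is the identity operator and $\mathbb{N}=\{1,2,\dots\}$. An operator $A$ in $\mathfrak{H}$ is $m$-sectorial with semi-angle $\alpha$ and vertex at $z=0$ if it is closed, densely defined and $m$-accretive, and its numerical range $W(A)=\{(u,Au):u\in\mathrm{dom}(A),\|u\|=1\}$ lies in the closed sector $\overline{S}_\alpha=\{0\}\cup\{z\in\mathbb{C}\setminus\{0\}:|\arg z|\le\alpha\}$. $\{e^{-tA}\}_{t\ge0}$ denotes the contraction $C_0$-semigroup generated by $A$ (sign convention: $-A$ is the infinitesimal generator in the usual sense). *)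

(* Defs.v *)
From Stdlib Require Export Reals Factorial.
From Coquelicot Require Export Coquelicot.
Open Scope R_scope.

(* The inner product is linear in its second argument. *)
Record HilbertSpace := {
  carrier :> CompleteNormedModule C_AbsRing;
  inner : carrier -> carrier -> C;
  inner_plus_r : forall x y z : carrier,
    inner x (plus y z) = Cplus (inner x y) (inner x z);
  inner_scal_r : forall (c : C) (x y : carrier),
    inner x (scal c y) = Cmult c (inner x y);
  inner_conj : forall x y : carrier, inner y x = Cconj (inner x y);
  inner_norm : forall x : carrier, inner x x = RtoC (norm x ^ 2)
}.

Arguments inner {h} _ _.

(* A possibly unbounded operator: the values of [app] outside [dom] are
   irrelevant. *)
Record operator (H : HilbertSpace) := {
  dom : H -> Prop;
  app :> H -> H;
  dom_zero : dom zero;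
  dom_plus : forall u v : H, dom u -> dom v -> dom (plus u v);
  dom_scal : forall (c : C) (u : H), dom u -> dom (scal c u);
  app_plus : forall u v : H,
    dom u -> dom v -> app (plus u v) = plus (app u) (app v);
  app_scal : forall (c : C) (u : H), dom u -> app (scal c u) = scal c (app u)
}.

Arguments dom {H} _ _.
Arguments app {H} _ _.

(* Operator norm of an everywhere defined map; [p_infty] if it is unbounded. *)
Definition opnorm {H : HilbertSpace} (B : H -> H) : Rbar :=
  Lub_Rbar (fun x : R => exists u : H, norm u <= 1 /\ x = norm (B u)).

(* For a bounded linear [B] the exponential series converges in operator norm;
   this is the value of its sum at [u]. *)
Definition exp_op {H : HilbertSpace} (B : H -> H) (u : H) : H :=
  iota (is_series (fun k : nat => scal (RtoC (/ INR (fact k))) (Nat.iter k B u))).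

Definition graph {H : HilbertSpace} (A : operator H) (p : H * H) : Prop :=
  dom A (fst p) /\ A (fst p) = snd p.

Definition closed_operator {H : HilbertSpace} (A : operator H) : Prop :=
  closed (graph A).

Definition densely_defined {H : HilbertSpace} (A : operator H) : Prop :=
  forall (u : H) (eps : R), 0 < eps ->
    exists v : H, dom A v /\ norm (minus v u) < eps.

(* Kato's definition: every [lam] with positive real part has
   [lam + A] boundedly invertible, with [|| (lam + A)^-1 || <= 1 / Re lam]. *)
Definition m_accretive {H : HilbertSpace} (A : operator H) : Prop :=
  forall lam : C, 0 < Re lam ->
    exists Rlam : H -> H,
      is_linear Rlam /\
      (forall v : H, dom A (Rlam v) /\
         plus (scal lam (Rlam v)) (A (Rlam v)) = v) /\
      (forall u : H, dom A u -> Rlam (plus (scal lam u) (A u)) = u) /\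
      Rbar_le (opnorm Rlam) (/ Re lam).

Definition numerical_range {H : HilbertSpace} (A : operator H) (z : C) : Prop :=
  exists u : H, dom A u /\ norm u = 1 /\ z = inner u (A u).

(* Principal argument in (-PI, PI], for [z <> 0]. *)
Definition Carg (z : C) : R :=
  if Rle_dec 0 (Im z) then acos (Re z / Cmod z) else - acos (Re z / Cmod z).

Definition closed_sector (alpha : R) (z : C) : Prop :=
  z = RtoC 0 \/ (z <> RtoC 0 /\ Rabs (Carg z) <= alpha).

Definition m_sectorial {H : HilbertSpace} (A : operator H) (alpha : R) : Prop :=
  closed_operator A /\ densely_defined A /\ m_accretive A /\
  (forall z : C, numerical_range A z -> closed_sector alpha z).

(* Only the values [T t] with [0 <= t] matter. *)
Record contraction_C0_semigroup {H : HilbertSpace} (T : R -> H -> H) : Prop := {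
  sg_linear : forall t : R, 0 <= t -> is_linear (T t);
  sg_zero : forall u : H, T 0 u = u;
  sg_plus : forall (s t : R) (u : H), 0 <= s -> 0 <= t ->
    T (s + t) u = T s (T t u);
  sg_cont : forall u : H, filterlim (fun t : R => T t u) (at_right 0) (locally u);
  sg_contraction : forall t : R, 0 <= t -> Rbar_le (opnorm (T t)) 1
}.

(* [T t = e^{-tA}]: the infinitesimal generator of [T], with its natural domain,
   is [-A]. *)
Definition semigroup_generated_by {H : HilbertSpace}
    (A : operator H) (T : R -> H -> H) : Prop :=
  contraction_C0_semigroup T /\
  forall u v : H,
    (dom A u /\ A u = v) <->
    filterlim (fun h : R => scal (RtoC (/ h)) (minus (T h u) u))
      (at_right 0) (locally (opp v)).

(* Main.v *)
Require Import Defs.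
From Stdlib Require Import Compare_dec Lra Lia.

(** Write [Q = T (t/n)]. The exponential of [n (Q - 1)] is the average of the
    powers [Q^k = T (k t/n)] with the Poisson weights [e^-n n^k/k!], whose mean
    is [n] and whose variance is [n]. Suppose that
    [T (k t/n) - T t = (k - n) D + O((k/n - 1)^2)] for some bounded [D]. The
    linear term averages to [0], the quadratic one to [O(n/n^2) = O(1/n)],
    which is the claim. Such a Taylor expansion expresses that the semigroup is
    holomorphic, i.e. that [t A e^(-tA)] is bounded.

    The expansion is proved for powers of the backward Euler step
    [B = (1 + h A)^-1] instead, uniformly in [h], and transported to the
    semigroup by the exponential formula [B^j u -> T (j h) u]
    ([exponential_formula]). The sector condition on the numerical range says
    exactly what is needed for [B - w (1 - B)] to be a contraction for all
    complex [w] with [|w| <= cos alpha] ([backward_euler_pencil]). So the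
    polynomial [w |-> (B - w (1 - B))^m v] is bounded by [norm v] on a disc,
    and Cauchy's estimate for its derivative at [0] reads
    [m cos alpha norm (B^(m-1) (1 - B) v) <= norm v] ([ritt_estimate]). Applying
    it twice bounds [B^l (1 - B)^2] by [4 / (cos alpha (l+1))^2], the second
    differences of [k |-> B^k v]; summing them gives the expansion
    ([taylor_quadratic]).

    The constant comes out as [N = 16]: the [4] above, and another [4] because
    the expansion at [b] uses second differences down to [b/2] only. *)

(** * Hilbert space preliminaries *)

Section HilbertBasics.
Variable H : HilbertSpace.
Implicit Types x y : H.

Lemma inner_zero_r x : inner x zero = RtoC 0.
Proof.
  replace (zero : H) with (scal (RtoC 0) (zero : H)).
  - rewrite inner_scal_r; ring.
  - apply (scal_zero_r (V := H)).
Qed.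

Lemma inner_opp_r x y : inner x (opp y) = Copp (inner x y).
Proof.
  assert (E : opp y = scal (RtoC (-1)) y).
  { transitivity (scal (opp (one : C_AbsRing)) y).
    { symmetry; apply (scal_opp_one (V := H)). }
    apply (f_equal (fun c : C => scal c y)).
    apply injective_projections; simpl; ring. }
  rewrite E, inner_scal_r; apply injective_projections; simpl; ring.
Qed.

Lemma inner_ext x y : (forall z : H, inner z x = inner z y) -> x = y.
Proof.
  intros E.
  apply (plus_reg_r (opp y)); rewrite plus_opp_r.
  apply (norm_eq_zero (V := H)).
  assert (K : inner (plus x (opp y)) (plus x (opp y)) = RtoC 0).
  { rewrite inner_plus_r, inner_opp_r, E; ring. }
  rewrite inner_norm in K.
  apply (f_equal fst) in K; cbn [fst RtoC] in K.
  apply Rsqr_0_uniq; unfold Rsqr.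
  rewrite <- K; simpl; rewrite Rmult_1_r; reflexivity.
Qed.
End HilbertBasics.

Ltac vec_expand :=
  unfold minus;
  repeat (rewrite inner_plus_r || rewrite inner_scal_r
          || rewrite inner_opp_r || rewrite inner_zero_r).

(** By [inner_ext] an identity between linear combinations of vectors becomes
    one between complex numbers, which [ring] decides. *)
Ltac vec_ring :=
  let z := fresh "z" in
  apply inner_ext; intros z; vec_expand;
  repeat (rewrite RtoC_plus || rewrite RtoC_minus || rewrite RtoC_mult
          || rewrite RtoC_opp);
  change (@plus C_AbelianMonoid) with Cplus;
  change (@plus C_AbsRing) with Cplus; change (@mult C_AbsRing) with Cmult;
  ring.

(** The variant for identities that need [h * / h = 1], with [0 < h] in the
    context. *)
Ltac vec_cancel h :=
  let z := fresh "z" in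
  let Hz := fresh in
  apply inner_ext; intros z; vec_expand;
  assert (Hz : RtoC h <> RtoC 0)
    by (intros Hz; apply (f_equal fst) in Hz; simpl in Hz; lra);
  rewrite !RtoC_inv by lra; field; exact Hz.

Section HilbertNorm.
Variable H : HilbertSpace.
Implicit Types x y : H.

Lemma norm_scal_C (c : C) x : norm (scal c x) <= Cmod c * norm x.
Proof. apply (norm_scal (V := H)). Qed.

(** The axioms of a normed module only bound [norm (scal r x)] from above; the
    equality comes from the inner product. *)
Lemma norm_scal_R (r : R) x : 0 <= r -> norm (scal (RtoC r) x) = r * norm x.
Proof.
  intros Hr.
  assert (K := inner_norm H (scal (RtoC r) x)).
  rewrite inner_scal_r, inner_conj, inner_scal_r, inner_norm in K.
  apply (f_equal fst) in K; simpl in K.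
  assert (h1 := norm_ge_0 x); assert (h2 := norm_ge_0 (scal (RtoC r) x)).
  apply Rsqr_inj; unfold Rsqr; [exact h2 | nra | nra].
Qed.

Lemma norm_opp_H x : norm (opp x) = norm x.
Proof. apply (norm_opp (V := H)). Qed.

Lemma norm_minus_le x y : norm (minus x y) <= norm x + norm y.
Proof.
  unfold minus; rewrite <- (norm_opp_H y); apply (norm_triangle (V := H)).
Qed.

Lemma norm_minus_sym x y : norm (minus x y) = norm (minus y x).
Proof.
  rewrite <- norm_opp_H; f_equal; vec_ring.
Qed.

Lemma norm_zero_H : norm (zero : H) = 0.
Proof. apply (norm_zero (V := H)). Qed.

Lemma norm_sum_n_le (a : nat -> H) (b : nat -> R) (n : nat) :
  (forall k, (k <= n)%nat -> norm (a k) <= b k) ->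
  norm (sum_n a n) <= sum_n b n.
Proof.
  induction n as [|n IH]; intros Hab.
  - rewrite !sum_O; apply Hab; lia.
  - rewrite !sum_Sn.
    eapply Rle_trans; [apply (norm_triangle (V := H))|].
    apply Rplus_le_compat; [apply IH; intros; apply Hab; lia | apply Hab; lia].
Qed.

Lemma sum_n_scal_r (c : nat -> C) x (n : nat) :
  sum_n (fun k => scal (c k) x) n = scal (sum_n (G := C_AbelianMonoid) c n) x.
Proof.
  induction n as [|n IH].
  - rewrite !sum_O; reflexivity.
  - rewrite !sum_Sn, IH; vec_ring.
Qed.
End HilbertNorm.

(** * Cauchy's estimate for vector polynomials *)

Definition cis (th : R) : C := (cos th, sin th).

Lemma cis_plus a b : cis (a + b) = Cmult (cis a) (cis b).
Proof.
  unfold cis, Cmult; simpl; rewrite cos_plus, sin_plus; f_equal; ring.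
Qed.

Lemma cis_pow a n : Cpow (cis a) n = cis (INR n * a).
Proof.
  induction n as [|n IH].
  - simpl; unfold cis; rewrite Rmult_0_l, cos_0, sin_0; reflexivity.
  - rewrite Cpow_S, IH, <- cis_plus, S_INR; f_equal; ring.
Qed.

Lemma Cmod_cis a : Cmod (cis a) = 1.
Proof.
  unfold Cmod, cis; cbn [fst snd]; rewrite <- sqrt_1; f_equal.
  rewrite <- (sin2_cos2 a); unfold Rsqr; ring.
Qed.

Lemma geometric_sum_C (q : C) (d : nat) :
  Cmult (Cminus q 1) (sum_n (G := C_AbelianMonoid) (fun j => Cpow q j) d)
  = Cminus (Cpow q (S d)) 1.
Proof.
  induction d as [|d IH].
  - rewrite sum_O; simpl; ring.
  - rewrite sum_Sn; change (@plus C_AbelianMonoid) with Cplus.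
    rewrite Cmult_plus_distr_l, IH, !Cpow_S; ring.
Qed.

Lemma cis_2PI_neq_1 x : -1 < x < 1 -> x <> 0 -> cis (2 * PI * x) <> RtoC 1.
Proof.
  intros Hx Hx0 E; apply (f_equal fst) in E; cbn [fst cis RtoC] in E.
  replace (2 * PI * x) with (2 * (PI * x)) in E by ring.
  rewrite cos_2a_sin in E.
  assert (P := PI_RGT_0).
  assert (S0 : sin (PI * x) <> 0).
  { destruct (Rlt_dec 0 x) as [Hp|Hn].
    - apply Rgt_not_eq, sin_gt_0; nra.
    - rewrite <- (Ropp_involutive (PI * x)), sin_neg.
      apply Ropp_neq_0_compat, Rgt_not_eq, sin_gt_0; nra. }
  apply S0; nra.
Qed.

(** The characters [j |-> exp (2 i PI j (i-1) / (d+1))] of the cyclic group of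
    order [d+1] are orthogonal to the trivial one unless [i = 1]; the argument
    stays real so that [i = 0] needs no separate treatment. *)
Lemma root_of_unity_sum (d i : nat) :
  (1 <= d)%nat -> (i <= d)%nat -> i <> 1%nat ->
  sum_n (G := C_AbelianMonoid)
    (fun j => cis ((INR i - 1) * (2 * PI * (INR j / INR (S d))))) d = RtoC 0.
Proof.
  intros Hd1 Hi Hi1.
  assert (Hd : 0 < INR (S d)) by (apply lt_0_INR; lia).
  set (q := cis (2 * PI * ((INR i - 1) / INR (S d)))).
  assert (Hq : q <> RtoC 1).
  { assert (I : INR i <= INR d) by (apply le_INR; lia).
    assert (P := pos_INR i).
    apply cis_2PI_neq_1.
    - rewrite S_INR in *; assert (0 <= INR d) by apply pos_INR.
      assert (1 <= INR d) by (apply (le_INR 1); lia).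
      split.
      + apply Rmult_lt_reg_r with (INR d + 1); [lra|].
        unfold Rdiv; rewrite Rmult_assoc, Rinv_l by lra; lra.
      + apply Rmult_lt_reg_r with (INR d + 1); [lra|].
        unfold Rdiv; rewrite Rmult_assoc, Rinv_l by lra; lra.
    - apply Rmult_integral_contrapositive_currified.
      + intros E; apply Hi1, INR_eq; simpl; lra.
      + apply Rinv_neq_0_compat; lra. }
  assert (E : forall j, cis ((INR i - 1) * (2 * PI * (INR j / INR (S d))))
                        = Cpow q j).
  { intros j; unfold q; rewrite cis_pow; f_equal; field; lra. }
  rewrite (sum_n_ext _ _ _ E).
  assert (G := geometric_sum_C q d).
  assert (Q : Cpow q (S d) = RtoC 1).
  { unfold q; rewrite cis_pow.
    replace (INR (S d) * (2 * PI * ((INR i - 1) / INR (S d))))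
      with (2 * INR i * PI - 2 * PI) by (field; lra).
    unfold cis, RtoC; f_equal.
    - rewrite cos_minus, cos_2PI, sin_2PI.
      replace (2 * INR i * PI) with (0 + 2 * INR i * PI) by ring.
      rewrite cos_period, sin_period, cos_0, sin_0; ring.
    - rewrite sin_minus, cos_2PI, sin_2PI.
      replace (2 * INR i * PI) with (0 + 2 * INR i * PI) by ring.
      rewrite cos_period, sin_period, cos_0, sin_0; ring. }
  rewrite Q in G.
  replace (Cminus 1 1) with (RtoC 0) in G by ring.
  assert (Hq' : Cminus q 1 <> RtoC 0).
  { intros Z; apply Hq; replace q with (Cplus (Cminus q 1) 1) by ring.
    rewrite Z; ring. }
  set (s := sum_n _ d : C) in *.
  transitivity (Cmult (Cmult (Cinv (Cminus q 1)) (Cminus q 1)) s).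
  - rewrite Cinv_l by exact Hq'; symmetry; apply Cmult_1_l.
  - rewrite <- Cmult_assoc, G; apply Cmult_0_r.
Qed.

Lemma sum_n_single (G : AbelianMonoid) (f : nat -> G) (d k : nat) :
  (k <= d)%nat -> (forall i, (i <= d)%nat -> i <> k -> f i = zero) ->
  sum_n f d = f k.
Proof.
  induction d as [|d IH]; intros Hk Hf.
  - rewrite sum_O; f_equal; lia.
  - rewrite sum_Sn; destruct (Nat.eq_dec k (S d)) as [->|n].
    + rewrite (sum_n_ext_loc f (fun _ => zero)).
      * unfold sum_n; rewrite (sum_n_m_const_zero (G := G)); apply plus_zero_l.
      * intros i Hi; apply Hf; lia.
    + rewrite (Hf (S d)), plus_zero_r by lia.
      apply IH; [lia | intros; apply Hf; lia].
Qed.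

Section Cauchy.
Variable H : HilbertSpace.

Definition polynomial (x : nat -> H) (d : nat) (w : C) : H :=
  sum_n (fun i => scal (Cpow w i) (x i)) d.

(** Averaging [w^-1 p(w)] over the [d+1] equidistant points of the circle
    isolates the linear coefficient exactly, because [p] has degree at most
    [d]; this replaces the contour integral. *)
Lemma cauchy_estimate_linear_coefficient (x : nat -> H) (d : nat) (c M : R) :
  (1 <= d)%nat -> 0 <= c ->
  (forall w : C, Cmod w <= c -> norm (polynomial x d w) <= M) ->
  c * norm (x 1%nat) <= M.
Proof.
  intros Hd Hc HM.
  assert (HN : 0 < INR (S d)) by (apply lt_0_INR; lia).
  set (th := fun j : nat => 2 * PI * (INR j / INR (S d))).
  set (w := fun j : nat => Cmult c (cis (th j))).
  assert (E : sum_n (fun j => scal (cis (- th j)) (polynomial x d (w j))) d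
              = scal (RtoC (INR (S d) * c)) (x 1%nat)).
  { transitivity (sum_n (fun i => scal (Cmult (RtoC (c ^ i))
       (sum_n (G := C_AbelianMonoid) (fun j => cis ((INR i - 1) * th j)) d))
       (x i)) d).
    - transitivity (sum_n (fun j => sum_n (fun i =>
        scal (Cmult (RtoC (c ^ i)) (cis ((INR i - 1) * th j))) (x i)) d) d).
      + apply sum_n_ext; intros j; unfold polynomial.
        rewrite <- (sum_n_scal_l (V := H)); apply sum_n_ext; intros i.
        unfold w; rewrite Cpow_mult_l, cis_pow, RtoC_pow.
        replace ((INR i - 1) * th j) with (- th j + INR i * th j) by ring.
        rewrite cis_plus; vec_ring.
      + rewrite sum_n_switch; apply sum_n_ext; intros i.
        transitivity (scal (RtoC (c ^ i)) (sum_n (fun j =>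
          scal (cis ((INR i - 1) * th j)) (x i)) d)).
        * rewrite <- (sum_n_scal_l (V := H)); apply sum_n_ext; intros j; vec_ring.
        * rewrite sum_n_scal_r; vec_ring.
    - rewrite (sum_n_single _ _ _ 1%nat Hd).
      + f_equal.
        rewrite (sum_n_ext _ (fun _ => RtoC 1)).
        * rewrite pow_1, Rmult_comm, RtoC_mult; f_equal.
          clear; induction d as [|d IH].
          -- rewrite sum_O; reflexivity.
          -- rewrite sum_Sn, IH, (S_INR (S d)), RtoC_plus; reflexivity.
        * intros j; simpl; unfold cis, RtoC.
          rewrite Rminus_diag, Rmult_0_l, cos_0, sin_0; reflexivity.
      + intros i Hi Hi1; unfold th; rewrite root_of_unity_sum by assumption.
        vec_ring. }
  assert (K : norm (scal (RtoC (INR (S d) * c)) (x 1%nat)) <= INR (S d) * M).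
  { rewrite <- E.
    eapply Rle_trans.
    - apply norm_sum_n_le with (b := fun _ => M); intros j _.
      eapply Rle_trans; [apply norm_scal_C|].
      rewrite Cmod_cis, Rmult_1_l; apply HM; unfold w.
      rewrite Cmod_mult, Cmod_cis, Cmod_R, Rabs_pos_eq; lra.
    - rewrite sum_n_const; lra. }
  rewrite norm_scal_R in K by nra.
  apply Rmult_le_reg_l with (INR (S d)); [exact HN | lra].
Qed.
End Cauchy.
Arguments polynomial {H}.

(** * Powers of a quasi-sectorial contraction *)

Section Iterates.
Variable H : HilbertSpace.
Variable B : H -> H.
Hypothesis B_plus : forall u v, B (plus u v) = plus (B u) (B v).
Hypothesis B_scal : forall (k : C) u, B (scal k u) = scal k (B u).

Lemma additive_zero : B zero = zero.
Proof.
  replace (zero : H) with (scal (RtoC 0) (zero : H)) at 1 by vec_ring.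
  rewrite B_scal; vec_ring.
Qed.

Lemma additive_minus u v : B (minus u v) = minus (B u) (B v).
Proof.
  replace (minus u v) with (plus u (scal (RtoC (-1)) v)) by vec_ring.
  rewrite B_plus, B_scal; vec_ring.
Qed.

Lemma iter_minus k u v :
  Nat.iter k B (minus u v) = minus (Nat.iter k B u) (Nat.iter k B v).
Proof.
  induction k as [|k IH]; [reflexivity | rewrite !Nat.iter_succ, IH; apply additive_minus].
Qed.

Lemma iter_contraction :
  (forall u, norm (B u) <= norm u) ->
  forall k u, norm (Nat.iter k B u) <= norm u.
Proof.
  intros HB k u; induction k as [|k IH]; [apply Rle_refl|].
  rewrite Nat.iter_succ; eapply Rle_trans; [apply HB | exact IH].
Qed.

(** Coefficients of [w |-> (B - w (1 - B))^m v]. *)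
Fixpoint pencil_coeff (v : H) (m : nat) (i : nat) : H :=
  match m with
  | O => match i with O => v | S _ => zero end
  | S m => minus (B (pencil_coeff v m i))
             match i with
             | O => zero
             | S i => minus (pencil_coeff v m i) (B (pencil_coeff v m i))
             end
  end.

Lemma pencil_polynomial_step v m d w :
  polynomial (pencil_coeff v (S m)) (S d) w =
  let p := polynomial (pencil_coeff v m) in
  minus (B (p (S d) w)) (scal w (minus (p d w) (B (p d w)))).
Proof.
  induction d as [|d IH]; cbn zeta in *; unfold polynomial in *.
  - rewrite !sum_Sn, !sum_O; cbn [pencil_coeff].
    rewrite !B_plus, !B_scal; cbn [Cpow]; vec_ring.
  - rewrite sum_Sn, IH.
    rewrite (sum_Sn _ (S d)), (sum_Sn _ d); cbn [pencil_coeff].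
    rewrite !B_plus, !B_scal, !Cpow_S. vec_ring.
Qed.

Lemma pencil_polynomial v m d w : (m <= d)%nat ->
  polynomial (pencil_coeff v m) d w =
  Nat.iter m (fun u => minus (B u) (scal w (minus u (B u)))) v.
Proof.
  revert d; induction m as [|m IH]; intros d Hd.
  - unfold polynomial; rewrite (sum_n_single _ _ _ 0%nat Hd).
    + change (Nat.iter 0 _ v) with v; cbn [pencil_coeff Cpow]; vec_ring.
    + intros [|i] _ Hi; [lia | cbn [pencil_coeff]; vec_ring].
  - destruct d as [|d]; [lia|].
    rewrite pencil_polynomial_step; cbn zeta.
    rewrite !IH by lia; reflexivity.
Qed.

Lemma pencil_coeff_0 v m : pencil_coeff v m 0 = Nat.iter m B v.
Proof.
  induction m as [|m IH]; [reflexivity|].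
  rewrite Nat.iter_succ, <- IH; cbn [pencil_coeff]; vec_ring.
Qed.

Lemma pencil_coeff_1 v m :
  pencil_coeff v (S m) 1 =
  scal (RtoC (- INR (S m))) (minus (Nat.iter m B v) (Nat.iter (S m) B v)).
Proof.
  induction m as [|m IH].
  - change (Nat.iter 1 B v) with (B v); change (Nat.iter 0 B v) with v.
    cbn [pencil_coeff INR]; rewrite additive_zero; vec_ring.
  - change (pencil_coeff v (S (S m)) 1) with
      (minus (B (pencil_coeff v (S m) 1))
         (minus (pencil_coeff v (S m) 0) (B (pencil_coeff v (S m) 0)))).
    rewrite IH, pencil_coeff_0, B_scal, additive_minus.
    change (B (Nat.iter m B v)) with (Nat.iter (S m) B v).
    change (B (Nat.iter (S m) B v)) with (Nat.iter (S (S m)) B v).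
    rewrite (S_INR (S m)); vec_ring.
Qed.

Variable c : R.
Hypothesis c_pos : 0 < c.
Hypothesis pencil_contraction : forall (w : C) u, Cmod w <= c ->
  norm (minus (B u) (scal w (minus u (B u)))) <= norm u.

(** Up to the factor [- (k+1)], the difference [B^k v - B^(k+1) v] is the
    derivative at [w = 0] of the polynomial [(B - w (1 - B))^(k+1) v], which is
    bounded by [norm v] on the disc of radius [c]. *)
Lemma ritt_estimate k v :
  c * INR (S k) * norm (minus (Nat.iter k B v) (Nat.iter (S k) B v)) <= norm v.
Proof.
  assert (K := cauchy_estimate_linear_coefficient H (pencil_coeff v (S k))
                 (S k) c (norm v) ltac:(lia) ltac:(lra)).
  rewrite pencil_coeff_1 in K.
  replace (scal (RtoC (- INR (S k)))
             (minus (Nat.iter k B v) (Nat.iter (S k) B v)))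
    with (opp (scal (RtoC (INR (S k)))
             (minus (Nat.iter k B v) (Nat.iter (S k) B v)))) in K by vec_ring.
  rewrite norm_opp_H, norm_scal_R in K by apply pos_INR.
  rewrite Rmult_assoc; apply K.
  intros w Hw; rewrite pencil_polynomial by lia.
  clear K; generalize (S k); intros m; induction m as [|m IH].
  - apply Rle_refl.
  - rewrite Nat.iter_succ; eapply Rle_trans; [apply pencil_contraction, Hw | exact IH].
Qed.

Definition fwd_diff (r : nat -> H) (k : nat) : H := minus (r (S k)) (r k).

(** [(1 - B)^2 B^l] is the product of [(1 - B) B^p] and [(1 - B) B^q] with
    [p + q = l] and [p], [q] both about [l/2]. *)
Lemma ritt_second_estimate l v :
  c ^ 2 * INR (S l) ^ 2 *
  norm (fwd_diff (fwd_diff (fun k => Nat.iter k B v)) l) <= 4 * norm v.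
Proof.
  set (q := (l / 2)%nat); set (p := (l - q)%nat).
  assert (Hq : (2 * q <= l)%nat) by (apply Nat.Div0.mul_div_le).
  assert (Hq2 : (l < 2 * S q)%nat).
  { apply Nat.mul_succ_div_gt; lia. }
  assert (Hp : (l = p + q)%nat) by lia.
  set (v' := minus (Nat.iter q B v) (Nat.iter (S q) B v)).
  assert (E1 := ritt_estimate q v); fold v' in E1.
  assert (E2 := ritt_estimate p v').
  assert (E : minus (Nat.iter p B v') (Nat.iter (S p) B v') =
              fwd_diff (fwd_diff (fun k => Nat.iter k B v)) l).
  { unfold v', fwd_diff; rewrite !iter_minus, <- !Nat.iter_add.
    replace (p + q)%nat with l by lia.
    replace (p + S q)%nat with (S l) by lia.
    replace (S p + q)%nat with (S l) by lia.
    replace (S p + S q)%nat with (S (S l)) by lia.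
    vec_ring. }
  rewrite E in E2; clear E; set (x := norm (fwd_diff _ l)) in *.
  assert (Hx : 0 <= x) by apply norm_ge_0.
  assert (Hv' : 0 <= norm v') by apply norm_ge_0.
  assert (Q : INR (S l) <= 2 * INR (S q)).
  { replace 2 with (INR 2) by reflexivity; rewrite <- mult_INR; apply le_INR; lia. }
  assert (P : INR (S l) <= 2 * INR (S p)).
  { replace 2 with (INR 2) by reflexivity; rewrite <- mult_INR; apply le_INR; lia. }
  assert (L : 0 < INR (S l)) by (apply lt_0_INR; lia).
  assert (A1 : c * INR (S l) * norm v' <= 2 * norm v).
  { apply Rle_trans with (2 * (c * INR (S q) * norm v')); [|lra].
    assert (0 <= c * norm v') by nra; nra. }
  assert (A2 : c * INR (S l) * x <= 2 * norm v').
  { apply Rle_trans with (2 * (c * INR (S p) * x)); [|lra].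
    assert (0 <= c * x) by nra; nra. }
  assert (0 < c * INR (S l)) by nra.
  replace (c ^ 2 * INR (S l) ^ 2 * x)
    with (c * INR (S l) * (c * INR (S l) * x)) by ring.
  apply Rle_trans with (c * INR (S l) * (2 * norm v')); [|lra].
  apply Rmult_le_compat_l; lra.
Qed.
End Iterates.
Arguments fwd_diff {H}.

(** * Second-order Taylor estimate for sequences *)

Section Taylor.
Variable H : HilbertSpace.
Variable r : nat -> H.

Lemma fwd_diff_oscillation (delta : R) (a j : nat) : 0 <= delta ->
  (forall l, (a <= l < a + j)%nat -> norm (fwd_diff (fwd_diff r) l) <= delta) ->
  norm (minus (fwd_diff r (a + j)) (fwd_diff r a)) <= INR j * delta.
Proof.
  intros Hd; induction j as [|j IH]; intros Hl.
  - rewrite Nat.add_0_r, minus_eq_zero, norm_zero_H; simpl; lra.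
  - replace (minus (fwd_diff r (a + S j)) (fwd_diff r a)) with
      (plus (minus (fwd_diff r (a + j)) (fwd_diff r a))
            (fwd_diff (fwd_diff r) (a + j))).
    + eapply Rle_trans; [apply (norm_triangle (V := H))|].
      rewrite S_INR, Rmult_plus_distr_r, Rmult_1_l.
      apply Rplus_le_compat; [apply IH; intros; apply Hl; lia | apply Hl; lia].
    + rewrite Nat.add_succ_r; unfold fwd_diff; vec_ring.
Qed.

Lemma taylor_forward (delta : R) (b j : nat) : 0 <= delta ->
  (forall l, (b <= l < b + j)%nat -> norm (fwd_diff (fwd_diff r) l) <= delta) ->
  norm (minus (minus (r (b + j)%nat) (r b)) (scal (RtoC (INR j)) (fwd_diff r b)))
  <= INR j ^ 2 * delta.
Proof.
  intros Hd; induction j as [|j IH]; intros Hl.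
  - rewrite Nat.add_0_r.
    match goal with |- norm ?x <= _ =>
      replace x with (zero : H) by (cbn [INR]; vec_ring) end.
    rewrite norm_zero_H; simpl; lra.
  - replace (minus (minus (r (b + S j)%nat) (r b))
                   (scal (RtoC (INR (S j))) (fwd_diff r b)))
      with (plus (minus (minus (r (b + j)%nat) (r b))
                        (scal (RtoC (INR j)) (fwd_diff r b)))
                 (minus (fwd_diff r (b + j)) (fwd_diff r b))).
    + eapply Rle_trans; [apply (norm_triangle (V := H))|].
      assert (A := IH ltac:(intros; apply Hl; lia)).
      assert (B := fwd_diff_oscillation delta b j Hd ltac:(intros; apply Hl; lia)).
      assert (0 <= INR j) by apply pos_INR.
      rewrite S_INR; nra.
    + rewrite Nat.add_succ_r, S_INR; unfold fwd_diff; vec_ring.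
Qed.

(** Induction moves the lower end point [a] and keeps the centre [a + j] fixed. *)
Lemma taylor_backward (delta : R) (j : nat) : 0 <= delta -> forall a : nat,
  (forall l, (a <= l < a + j)%nat -> norm (fwd_diff (fwd_diff r) l) <= delta) ->
  norm (plus (minus (r a) (r (a + j)%nat))
             (scal (RtoC (INR j)) (fwd_diff r (a + j))))
  <= INR j ^ 2 * delta.
Proof.
  intros Hd; induction j as [|j IH]; intros a Hl.
  - rewrite Nat.add_0_r.
    match goal with |- norm ?x <= _ =>
      replace x with (zero : H) by (cbn [INR]; vec_ring) end.
    rewrite norm_zero_H; simpl; lra.
  - assert (A := IH (S a) ltac:(intros; apply Hl; lia)).
    assert (B := fwd_diff_oscillation delta a (S j) Hd Hl).
    rewrite Nat.add_succ_r in *; rewrite Nat.add_succ_l in A.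
    replace (plus (minus (r a) (r (S (a + j))))
                  (scal (RtoC (INR (S j))) (fwd_diff r (S (a + j)))))
      with (plus (plus (minus (r (S a)) (r (S (a + j))))
                       (scal (RtoC (INR j)) (fwd_diff r (S (a + j)))))
                 (minus (fwd_diff r (S (a + j))) (fwd_diff r a))).
    + eapply Rle_trans; [apply (norm_triangle (V := H))|].
      assert (0 <= INR j) by apply pos_INR.
      rewrite S_INR in *; nra.
    + rewrite S_INR; unfold fwd_diff; vec_ring.
Qed.

(** Far below [b], where the second differences are not controlled, the three
    terms are estimated separately and [(a/b - 1)^2 >= 1/4] pays for it. *)
Lemma taylor_quadratic (c V : R) (a b : nat) :
  0 < c <= 1 -> (1 <= b)%nat ->
  (forall k, norm (r k) <= V) ->
  (forall k, c * INR (S k) * norm (fwd_diff r k) <= V) ->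
  (forall k, c ^ 2 * INR (S k) ^ 2 * norm (fwd_diff (fwd_diff r) k) <= 4 * V) ->
  norm (minus (minus (r a) (r b))
              (scal (RtoC (INR a - INR b)) (fwd_diff r b)))
  <= 16 * V / c ^ 2 * (INR a / INR b - 1) ^ 2.
Proof.
  intros Hc Hb H0 H1 H2.
  assert (HV : 0 <= V) by (eapply Rle_trans; [apply (norm_ge_0 (r 0%nat)) | apply H0]).
  assert (Pb : 1 <= INR b) by (apply (le_INR 1); lia).
  assert (Pc : 0 < c ^ 2) by (apply pow_lt; lra).
  set (delta := 16 * V / (c ^ 2 * INR b ^ 2)).
  assert (Hden : 0 < c ^ 2 * INR b ^ 2).
  { apply Rmult_lt_0_compat; [exact Pc | apply pow_lt; lra]. }
  assert (Hdelta : 0 <= delta).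
  { apply Rdiv_le_0_compat; lra. }
  assert (D2 : forall l, (b <= 2 * l)%nat ->
            norm (fwd_diff (fwd_diff r) l) <= delta).
  { intros l Hl; apply Rle_div_r; [exact Hden|].
    assert (K := H2 l); set (x := norm _) in *.
    assert (Hx : 0 <= x) by apply norm_ge_0.
    assert (Hbl : INR b <= 2 * INR (S l)).
    { replace 2 with (INR 2) by reflexivity; rewrite <- mult_INR; apply le_INR; lia. }
    assert (INR b ^ 2 <= 4 * INR (S l) ^ 2) by nra.
    assert (0 <= c ^ 2 * x) by nra.
    replace (x * (c ^ 2 * INR b ^ 2)) with (c ^ 2 * x * INR b ^ 2) by ring.
    apply Rle_trans with (c ^ 2 * x * (4 * INR (S l) ^ 2)); [|lra].
    apply Rmult_le_compat_l; assumption. }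
  assert (Q : 16 * V / c ^ 2 * (INR a / INR b - 1) ^ 2
              = (INR a - INR b) ^ 2 * delta).
  { unfold delta; field; split; apply Rgt_not_eq; lra. }
  destruct (le_lt_dec b a) as [Hab|Hab].
  - rewrite Q; destruct (Nat.le_exists_sub b a Hab) as [j [-> _]].
    rewrite Nat.add_comm, plus_INR.
    replace (INR b + INR j - INR b) with (INR j) by ring.
    apply taylor_forward; [exact Hdelta|]; intros l Hl; apply D2; lia.
  - destruct (le_lt_dec b (2 * a)) as [Hab2|Hab2].
    + rewrite Q; destruct (Nat.le_exists_sub a b ltac:(lia)) as [j [E _]].
      rewrite Nat.add_comm in E; subst b.
      assert (T := taylor_backward delta j Hdelta a
                     ltac:(intros l Hl; apply D2; lia)).
      rewrite plus_INR.
      replace ((INR a - (INR a + INR j)) ^ 2) with (INR j ^ 2) by ring.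
      replace (RtoC (INR a - (INR a + INR j))) with (RtoC (- INR j))
        by (f_equal; ring).
      replace (minus (minus (r a) (r (a + j)%nat)) _) with
        (plus (minus (r a) (r (a + j)%nat))
              (scal (RtoC (INR j)) (fwd_diff r (a + j)))) by vec_ring.
      exact T.
    + assert (Hab3 : 2 * INR a <= INR b).
      { replace 2 with (INR 2) by reflexivity; rewrite <- mult_INR; apply le_INR; lia. }
      assert (Pa : 0 <= INR a) by apply pos_INR.
      assert (X : norm (minus (minus (r a) (r b))
                (scal (RtoC (INR a - INR b)) (fwd_diff r b))) <= 3 * V / c).
      { eapply Rle_trans; [apply norm_minus_le|].
        assert (A := norm_minus_le _ (r a) (r b)).
        assert (Ha := H0 a); assert (Hrb := H0 b).
        replace (scal (RtoC (INR a - INR b)) (fwd_diff r b)) with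
          (opp (scal (RtoC (INR b - INR a)) (fwd_diff r b))) by vec_ring.
        rewrite norm_opp_H, norm_scal_R by lra.
        assert (K := H1 b); set (x := norm (fwd_diff r b)) in *.
        assert (0 <= x) by apply norm_ge_0.
        apply Rle_div_r; [lra|].
        rewrite S_INR in K.
        assert ((INR b - INR a) * (c * x) <= (INR b + 1) * (c * x)).
        { apply Rmult_le_compat_r; nra. }
        assert (norm (minus (r a) (r b)) * c <= 2 * V * c).
        { apply Rmult_le_compat_r; lra. }
        nra. }
      eapply Rle_trans; [exact X|].
      assert (R0 : INR a / INR b <= / 2).
      { apply Rle_div_l; [lra|]; lra. }
      assert (R1 : / 4 <= (INR a / INR b - 1) ^ 2) by nra.
      apply Rle_trans with (16 * V / c ^ 2 * / 4).
      * replace (16 * V / c ^ 2 * / 4) with (4 * V / c * / c)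
          by (field; lra).
        assert (1 <= / c).
        { rewrite <- Rinv_1; apply Rinv_le_contravar; lra. }
        assert (0 <= V / c) by (apply Rdiv_le_0_compat; lra).
        unfold Rdiv in *; nra.
      * apply Rmult_le_compat_l; [|exact R1].
        apply Rdiv_le_0_compat; lra.
Qed.
End Taylor.

(** * Resolvents of a sectorial operator *)

(** [B] is the inverse of [1 + h A], one step of the backward Euler scheme for
    [u' = - A u]. *)
Record backward_euler {H : HilbertSpace} (A : operator H) (h : R) (B : H -> H)
  : Prop := {
  be_plus : forall u v, B (plus u v) = plus (B u) (B v);
  be_scal : forall (k : C) u, B (scal k u) = scal k (B u);
  be_dom : forall v, dom A (B v);
  be_right : forall v, plus (B v) (scal (RtoC h) (A (B v))) = v;
  be_left : forall u, dom A u -> B (plus u (scal (RtoC h) (A u))) = u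
}.

Lemma backward_euler_exists (H : HilbertSpace) (A : operator H) (h : R) :
  m_accretive A -> 0 < h -> exists B, backward_euler A h B.
Proof.
  intros HA Hh.
  assert (Hi : 0 < / h) by (apply Rinv_0_lt_compat; exact Hh).
  destruct (HA (RtoC (/ h)) Hi) as [Q [[Qp Qs _] [Qr [Ql _]]]].
  exists (fun v => scal (RtoC (/ h)) (Q v)); split.
  - intros u v; rewrite Qp; vec_ring.
  - intros k u; rewrite Qs; vec_ring.
  - intros v; apply dom_scal, Qr.
  - intros v; destruct (Qr v) as [Hd Hv].
    rewrite app_scal by exact Hd; rewrite <- Hv at 3.
    vec_cancel h.
  - intros u Hu; rewrite <- (Ql u Hu) at 3; rewrite <- Qs; f_equal.
    vec_cancel h.
Qed.

Lemma Re_mult_R (r : R) (z : C) : Re (Cmult (RtoC r) z) = r * Re z.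
Proof. destruct z as [x y]; simpl; ring. Qed.

Lemma closed_sector_Re (alpha : R) (z : C) : 0 <= alpha < PI / 2 ->
  closed_sector alpha z -> cos alpha * Cmod z <= Re z.
Proof.
  intros Ha [-> | [Hz HC]].
  - rewrite Cmod_0; simpl; lra.
  - assert (Pz : 0 < Cmod z) by (apply Cmod_gt_0, Hz).
    assert (Q : -1 <= Re z / Cmod z <= 1).
    { assert (K := re_le_Cmod z); apply Rabs_le_between in K.
      split; [apply Rle_div_r | apply Rle_div_l]; lra. }
    assert (B := acos_bound (Re z / Cmod z)).
    assert (Hac : acos (Re z / Cmod z) <= alpha).
    { unfold Carg in HC; destruct Rle_dec; rewrite ?Rabs_Ropp in HC;
        rewrite Rabs_pos_eq in HC; lra. }
    assert (K : cos alpha <= cos (acos (Re z / Cmod z))).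
    { apply cos_decr_1; lra. }
    rewrite cos_acos in K by exact Q.
    apply Rle_div_r in K; lra.
Qed.

Section Sectorial.
Variable H : HilbertSpace.
Variable A : operator H.
Variable alpha : R.
Hypothesis alpha_range : 0 <= alpha < PI / 2.
Hypothesis A_sector :
  forall z : C, numerical_range A z -> closed_sector alpha z.

Lemma inner_zero_l (x : H) : inner zero x = RtoC 0.
Proof.
  rewrite inner_conj, inner_zero_r; apply injective_projections; simpl; ring.
Qed.

Lemma inner_scal_l (c : C) (x y : H) :
  inner (scal c x) y = Cmult (Cconj c) (inner x y).
Proof.
  rewrite inner_conj, inner_scal_r, (inner_conj H x y).
  apply injective_projections; simpl; ring.
Qed.

Lemma sectorial_form (u : H) : dom A u ->
  cos alpha * Cmod (inner u (A u)) <= Re (inner u (A u)).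
Proof.
  intros Hu.
  destruct (Req_dec (norm u) 0) as [Z|NZ].
  - apply (norm_eq_zero (V := H)) in Z; subst u.
    rewrite inner_zero_l, Cmod_0; simpl; lra.
  - assert (P : 0 < norm u) by (assert (0 <= norm u) by apply norm_ge_0; lra).
    set (s := / norm u).
    assert (Ps : 0 < s) by (apply Rinv_0_lt_compat, P).
    assert (E : inner (scal (RtoC s) u) (A (scal (RtoC s) u))
                = Cmult (RtoC (s * s)) (inner u (A u))).
    { rewrite app_scal by exact Hu; rewrite inner_scal_l, inner_scal_r.
      apply injective_projections; simpl; ring. }
    assert (K : closed_sector alpha (Cmult (RtoC (s * s)) (inner u (A u)))).
    { apply A_sector; exists (scal (RtoC s) u); split; [apply dom_scal, Hu|].
      split; [|symmetry; exact E].
      rewrite norm_scal_R by lra; unfold s; field; exact NZ. }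
    apply closed_sector_Re in K; [|exact alpha_range].
    assert (Pss : 0 < s * s) by nra.
    rewrite Cmod_mult, Cmod_R, Rabs_pos_eq in K by lra.
    apply Rmult_le_reg_l with (s * s); [exact Pss|].
    replace (s * s * Re (inner u (A u)))
      with (Re (Cmult (RtoC (s * s)) (inner u (A u)))) by apply Re_mult_R.
    lra.
Qed.

Lemma norm_sq (x : H) : norm x ^ 2 = Re (inner x x).
Proof. rewrite inner_norm; reflexivity. Qed.

Lemma norm_sq_minus_scal (w : C) (u g : H) :
  norm (minus u (scal w g)) ^ 2 =
  norm u ^ 2 - 2 * Re (Cmult w (inner u g)) + Cmod w ^ 2 * norm g ^ 2.
Proof.
  rewrite norm_sq; set (x := minus u (scal w g)).
  assert (E : inner x x = Cminus (inner x u) (Cmult w (inner x g))).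
  { unfold x at 2; vec_expand; ring. }
  rewrite E, (inner_conj H u x), (inner_conj H g x).
  unfold x; vec_expand; rewrite (inner_conj H u g), !inner_norm.
  set (a := norm u ^ 2); set (b := norm g ^ 2).
  replace (Cmod w ^ 2) with (Re w ^ 2 + Im w ^ 2).
  - destruct w as [w1 w2]; destruct (inner u g) as [z1 z2]; simpl; ring.
  - unfold Cmod; rewrite pow2_sqrt; [reflexivity|].
    apply Rplus_le_le_0_compat; apply pow2_ge_0.
Qed.

(** With [u = B v] and [g = h A u] one has [v = u + g] and [(1 - B) v = g], so
    the claim compares [u - w g] with [u + g]: the cross term
    [2 Re ((1 + w) (u, g))] stays nonnegative because [(u, g)] lies in the
    sector and [|w| <= cos alpha]. *)
Lemma backward_euler_pencil (h : R) (B : H -> H) :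
  0 < h -> backward_euler A h B -> forall (w : C) v, Cmod w <= cos alpha ->
  norm (minus (B v) (scal w (minus v (B v)))) <= norm v.
Proof.
  intros Hh HB w v Hw.
  set (u := B v); set (g := scal (RtoC h) (A u)).
  assert (Hv : v = minus u (scal (RtoC (-1)) g)).
  { unfold g, u; rewrite <- (be_right _ _ _ HB v) at 1; vec_ring. }
  replace (minus v u) with g by (rewrite Hv; vec_ring).
  rewrite Hv.
  assert (Hz : cos alpha * Cmod (inner u g) <= Re (inner u g)).
  { unfold g; rewrite inner_scal_r, Cmod_mult, Cmod_R, Rabs_pos_eq by lra.
    assert (K := sectorial_form u (be_dom _ _ _ HB v)).
    replace (Re (Cmult h (inner u (A u)))) with (h * Re (inner u (A u)))
      by (symmetry; apply Re_mult_R).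
    nra. }
  apply Rsqr_incr_0; [|apply norm_ge_0|apply norm_ge_0].
  rewrite !Rsqr_pow2, !norm_sq_minus_scal, Cmod_R.
  assert (Cb := COS_bound alpha).
  assert (Pw : 0 <= Cmod w) by apply Cmod_ge_0.
  assert (Pz : 0 <= Cmod (inner u g)) by apply Cmod_ge_0.
  assert (Pg : 0 <= norm g ^ 2) by apply pow2_ge_0.
  assert (X : - Re (Cmult w (inner u g)) <= Re (inner u g)).
  { assert (K := re_le_Cmod (Cmult w (inner u g))).
    apply Rabs_le_between in K; rewrite Cmod_mult in K.
    assert (Cmod w * Cmod (inner u g) <= cos alpha * Cmod (inner u g)).
    { apply Rmult_le_compat_r; assumption. }
    lra. }
  rewrite Re_mult_R.
  replace (Rabs (-1)) with 1 by (rewrite Rabs_left; lra).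
  assert (Cmod w ^ 2 * norm g ^ 2 <= 1 * norm g ^ 2).
  { apply Rmult_le_compat_r; [exact Pg | nra]. }
  lra.
Qed.

Lemma cos_alpha_range : 0 < cos alpha <= 1.
Proof. split; [apply cos_gt_0; lra | apply COS_bound]. Qed.

Lemma backward_euler_contraction (h : R) (B : H -> H) :
  0 < h -> backward_euler A h B -> forall v, norm (B v) <= norm v.
Proof.
  intros Hh HB v.
  assert (K := backward_euler_pencil h B Hh HB (RtoC 0) v).
  replace (minus (B v) (scal (RtoC 0) (minus v (B v)))) with (B v) in K
    by vec_ring.
  apply K; rewrite Cmod_0; apply Rlt_le, cos_alpha_range.
Qed.

Lemma backward_euler_taylor (h : R) (B : H -> H) :
  0 < h -> backward_euler A h B -> forall (a b : nat) v, (1 <= b)%nat ->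
  let r := fun k => Nat.iter k B v in
  norm (minus (minus (r a) (r b)) (scal (RtoC (INR a - INR b)) (fwd_diff r b)))
  <= 16 * norm v / cos alpha ^ 2 * (INR a / INR b - 1) ^ 2.
Proof.
  intros Hh HB a b v Hb r.
  assert (Bp := be_plus _ _ _ HB); assert (Bs := be_scal _ _ _ HB).
  assert (Hc := cos_alpha_range); assert (Pen := backward_euler_pencil h B Hh HB).
  apply taylor_quadratic; auto.
  - intros k; apply iter_contraction; apply (backward_euler_contraction h); assumption.
  - intros k; unfold fwd_diff; rewrite norm_minus_sym.
    apply ritt_estimate; auto; lra.
  - intros k; apply ritt_second_estimate; auto; lra.
Qed.
End Sectorial.

(** * The exponential formula *)

Section Euler.
Variable H : HilbertSpace.
Variable A : operator H.
Variable T : R -> H -> H.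
Hypothesis T_gen : semigroup_generated_by A T.

Lemma opnorm_le_1_contraction (B : H -> H) :
  is_linear B -> Rbar_le (opnorm B) 1 -> forall u, norm (B u) <= norm u.
Proof.
  intros [Bp Bs [M [HM Bn]]] HB u.
  destruct (Req_dec (norm u) 0) as [Z|NZ].
  - assert (K := Bn u); rewrite Z in *; lra.
  - assert (P : 0 < norm u) by (assert (0 <= norm u) by apply norm_ge_0; lra).
    assert (Pi : 0 < / norm u) by (apply Rinv_0_lt_compat, P).
    set (u1 := scal (RtoC (/ norm u)) u).
    assert (N1 : norm u1 = 1).
    { unfold u1; rewrite norm_scal_R by lra; field; exact NZ. }
    assert (K : Rbar_le (norm (B u1)) 1).
    { eapply Rbar_le_trans; [|exact HB].
      apply (proj1 (Lub_Rbar_correct _)); exists u1; split; [lra | reflexivity]. }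
    unfold u1 in K; rewrite Bs, norm_scal_R in K by lra; cbn in K.
    apply Rmult_le_reg_l with (/ norm u); [exact Pi|].
    rewrite Rinv_l; [exact K | exact NZ].
Qed.

Lemma T_contraction t u : 0 <= t -> norm (T t u) <= norm u.
Proof.
  intros Ht; apply opnorm_le_1_contraction.
  - apply (sg_linear _ (proj1 T_gen) t Ht).
  - apply (sg_contraction _ (proj1 T_gen) t Ht).
Qed.

Lemma T_plus t u v : 0 <= t -> T t (plus u v) = plus (T t u) (T t v).
Proof. intros Ht; apply (linear_plus _ (sg_linear _ (proj1 T_gen) t Ht)). Qed.

Lemma T_scal t (k : C) u : 0 <= t -> T t (scal k u) = scal k (T t u).
Proof. intros Ht; apply (linear_scal _ (sg_linear _ (proj1 T_gen) t Ht)). Qed.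

Lemma T_minus t u v : 0 <= t -> T t (minus u v) = minus (T t u) (T t v).
Proof.
  intros Ht; apply additive_minus; intros; [apply T_plus | apply T_scal]; exact Ht.
Qed.

Lemma T_iter h j u : 0 <= h -> Nat.iter j (T h) u = T (INR j * h) u.
Proof.
  intros Hh; induction j as [|j IH].
  - simpl; rewrite Rmult_0_l; symmetry; apply (sg_zero _ (proj1 T_gen)).
  - rewrite Nat.iter_succ, IH, <- (sg_plus _ (proj1 T_gen)).
    + f_equal; rewrite S_INR; ring.
    + exact Hh.
    + apply Rmult_le_pos; [apply pos_INR | exact Hh].
Qed.

Definition diff_quotient (h : R) (u : H) : H :=
  scal (RtoC (/ h)) (minus (T h u) u).

Lemma generator_iff u v :
  (dom A u /\ A u = v) <->
  forall eps : R, 0 < eps -> exists delta, 0 < delta /\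
    forall h, 0 < h < delta -> norm (plus (diff_quotient h u) v) < eps.
Proof.
  rewrite (proj2 T_gen u v), (filterlim_locally_ball_norm (U := H)).
  assert (E : forall h, minus (diff_quotient h u) (opp v)
                        = plus (diff_quotient h u) v) by (intros; vec_ring).
  split; intros L.
  - intros eps Heps; destruct (L (mkposreal eps Heps)) as [d Hd].
    exists d; split; [apply cond_pos|]; intros h Hh.
    rewrite <- E; apply (Hd h); [|lra].
    apply (norm_compat1 (V := R_NormedModule)).
    change (Rabs (h - 0) < d); rewrite Rminus_0_r, Rabs_pos_eq; lra.
  - intros eps; destruct (L eps (cond_pos eps)) as [d [Pd Hd]].
    exists (mkposreal d Pd); intros h Hball Hh.
    change (norm (minus (diff_quotient h u) (opp v)) < eps); rewrite E; apply Hd.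
    change (Rabs (h - 0) < d) in Hball; rewrite Rminus_0_r, Rabs_pos_eq in Hball; lra.
Qed.

Lemma T_preserves_dom t u : 0 <= t -> dom A u ->
  dom A (T t u) /\ A (T t u) = T t (A u).
Proof.
  intros Ht Hu; apply generator_iff; intros eps Heps.
  destruct (proj1 (generator_iff u (A u)) (conj Hu eq_refl) eps Heps)
    as [d [Pd Hd]].
  exists d; split; [exact Pd|]; intros h Hh.
  replace (plus (diff_quotient h (T t u)) (T t (A u)))
    with (T t (plus (diff_quotient h u) (A u))).
  - eapply Rle_lt_trans; [apply T_contraction, Ht | apply Hd, Hh].
  - unfold diff_quotient; rewrite T_plus, T_scal, T_minus by exact Ht.
    rewrite <- !(sg_plus _ (proj1 T_gen)) by lra.
    rewrite (Rplus_comm t h); reflexivity.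
Qed.

(** Commuting with [A] on its domain, [T t] commutes with the inverse of
    [1 + h A]. *)
Lemma T_backward_euler_comm t h B v : 0 <= t -> backward_euler A h B ->
  T t (B v) = B (T t v).
Proof.
  intros Ht HB.
  destruct (T_preserves_dom t (B v) Ht (be_dom _ _ _ HB v)) as [Hd E].
  rewrite <- (be_left _ _ _ HB (T t (B v)) Hd), E, <- T_scal, <- T_plus,
    (be_right _ _ _ HB) by exact Ht; reflexivity.
Qed.

Variable alpha : R.
Hypothesis alpha_range : 0 <= alpha < PI / 2.
Hypothesis A_sector :
  forall z : C, numerical_range A z -> closed_sector alpha z.
Hypothesis A_dense : densely_defined A.

Lemma backward_euler_defect h B u : backward_euler A h B -> dom A u ->
  minus (B u) u = opp (scal (RtoC h) (B (A u))).
Proof.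
  intros HB Hu; rewrite <- (be_left _ _ _ HB u Hu) at 2.
  rewrite (be_plus _ _ _ HB), (be_scal _ _ _ HB); vec_ring.
Qed.

(** On the domain [B v - v = - h B (A v)] is [O(h)]; density and contractivity
    extend the convergence to every vector. *)
Lemma backward_euler_to_identity v eps : 0 < eps -> exists delta, 0 < delta /\
  forall h B, 0 < h < delta -> backward_euler A h B -> norm (minus (B v) v) < eps.
Proof.
  intros Heps; destruct (A_dense v (eps / 4) ltac:(lra)) as [v' [Hv' Hd]].
  assert (Pa : 0 <= norm (A v')) by apply norm_ge_0.
  exists (eps / 4 / (norm (A v') + 1)); split.
  - apply Rdiv_lt_0_compat; lra.
  - intros h B Hh HB.
    assert (Bc := backward_euler_contraction H A alpha alpha_range A_sector
                    h B ltac:(lra) HB).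
    replace (minus (B v) v) with
      (plus (minus (minus v' v) (B (minus v' v))) (minus (B v') v')).
    + eapply Rle_lt_trans; [apply (norm_triangle (V := H))|].
      assert (K1 := norm_minus_le _ (minus v' v) (B (minus v' v))).
      assert (K2 := Bc (minus v' v)).
      rewrite (backward_euler_defect h B v' HB Hv'), norm_opp_H, norm_scal_R by lra.
      assert (K3 := Bc (A v')).
      assert (K4 : h * (norm (A v') + 1) < eps / 4).
      { apply Rlt_div_r; lra. }
      assert (h * norm (B (A v')) <= h * norm (A v')).
      { apply Rmult_le_compat_l; lra. }
      change (norm (minus v' v) < eps / 4) in Hd.
      lra.
    + rewrite (additive_minus H B (be_plus _ _ _ HB) (be_scal _ _ _ HB)); vec_ring.
Qed.

(** [P^j - Q^j] is the sum of [P^(j-1-i) Q^i (P - Q)] over [i < j]; commutation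
    lets [P - Q] act first, on the one vector [u] where it is known to be small. *)
Lemma telescoping_powers (P Q : H -> H) j u :
  (forall u v, P (plus u v) = plus (P u) (P v)) ->
  (forall (k : C) u, P (scal k u) = scal k (P u)) ->
  (forall u v, Q (plus u v) = plus (Q u) (Q v)) ->
  (forall (k : C) u, Q (scal k u) = scal k (Q u)) ->
  (forall u, norm (P u) <= norm u) -> (forall u, norm (Q u) <= norm u) ->
  (forall u, Q (P u) = P (Q u)) ->
  norm (minus (Nat.iter j P u) (Nat.iter j Q u)) <= INR j * norm (minus (P u) (Q u)).
Proof.
  intros Pp Ps Qp Qs Pc Qc QP; induction j as [|j IH].
  - simpl; rewrite minus_eq_zero, norm_zero_H; lra.
  - assert (E : Nat.iter j Q (P u) = P (Nat.iter j Q u)).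
    { clear IH; induction j as [|j IH]; [reflexivity|].
      rewrite !Nat.iter_succ, IH; apply QP. }
    replace (minus (Nat.iter (S j) P u) (Nat.iter (S j) Q u)) with
      (plus (P (minus (Nat.iter j P u) (Nat.iter j Q u)))
            (Nat.iter j Q (minus (P u) (Q u)))).
    + eapply Rle_trans; [apply (norm_triangle (V := H))|].
      rewrite S_INR, Rmult_plus_distr_r, Rmult_1_l; apply Rplus_le_compat.
      * eapply Rle_trans; [apply Pc | exact IH].
      * apply iter_contraction, Qc.
    + rewrite additive_minus, iter_minus, E by assumption.
      rewrite <- Nat.iter_succ_r, <- Nat.iter_succ; vec_ring.
Qed.

(** For [u] in the domain both [(B u - u)/h] and [(T h u - u)/h] tend to [- A u],
    so one step errs by [o(h)] and [j <= L/h] steps by [o(1)]. *)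
Lemma exponential_formula_dom u L eps : dom A u -> 0 <= L -> 0 < eps ->
  exists delta, 0 < delta /\ forall h B j,
    0 < h < delta -> backward_euler A h B -> INR j * h <= L ->
    norm (minus (Nat.iter j B u) (T (INR j * h) u)) <= eps.
Proof.
  intros Hu HL Heps.
  (* Two defects of size [e] per unit of time, over a time at most [L]. *)
  set (e := eps / (2 * (L + 1))).
  assert (Pe : 0 < e) by (apply Rdiv_lt_0_compat; lra).
  destruct (backward_euler_to_identity (A u) e Pe) as [d1 [Pd1 H1]].
  destruct (proj1 (generator_iff u (A u)) (conj Hu eq_refl) e Pe) as [d2 [Pd2 H2]].
  exists (Rmin d1 d2); split; [apply Rmin_pos; assumption|].
  intros h B j Hh HB Hj.
  assert (Hh1 : 0 < h < d1) by (split; [|eapply Rlt_le_trans, Rmin_l]; apply Hh).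
  assert (Hh2 : 0 < h < d2) by (split; [|eapply Rlt_le_trans, Rmin_r]; apply Hh).
  rewrite <- T_iter by lra.
  eapply Rle_trans.
  { apply telescoping_powers.
    - apply (be_plus _ _ _ HB).
    - apply (be_scal _ _ _ HB).
    - intros; apply T_plus; lra.
    - intros; apply T_scal; lra.
    - apply (backward_euler_contraction H A alpha alpha_range A_sector h B); [lra | exact HB].
    - intros; apply T_contraction; lra.
    - intros v; apply (T_backward_euler_comm h h); [lra | exact HB]. }
  assert (E : minus (B u) (T h u) = opp (scal (RtoC h)
     (plus (minus (B (A u)) (A u)) (plus (diff_quotient h u) (A u))))).
  { replace (minus (B u) (T h u)) with (minus (minus (B u) u) (minus (T h u) u))
      by vec_ring.
    rewrite (backward_euler_defect h B u HB Hu).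
    unfold diff_quotient; vec_cancel h. }
  rewrite E, norm_opp_H, norm_scal_R by lra.
  assert (K : norm (plus (minus (B (A u)) (A u)) (plus (diff_quotient h u) (A u)))
              <= 2 * e).
  { eapply Rle_trans; [apply (norm_triangle (V := H))|].
    assert (K1 := H1 h B Hh1 HB); assert (K2 := H2 h Hh2); lra. }
  rewrite <- Rmult_assoc.
  apply Rle_trans with (L * (2 * e)).
  - apply Rmult_le_compat; [|apply norm_ge_0|exact Hj|exact K].
    apply Rmult_le_pos; [apply pos_INR | lra].
  - assert (X : (L + 1) * (2 * e) = eps) by (unfold e; field; lra). nra.
Qed.

Lemma exponential_formula u L eps : 0 <= L -> 0 < eps ->
  exists delta, 0 < delta /\ forall h B j,
    0 < h < delta -> backward_euler A h B -> INR j * h <= L ->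
    norm (minus (Nat.iter j B u) (T (INR j * h) u)) <= eps.
Proof.
  intros HL Heps.
  destruct (A_dense u (eps / 4) ltac:(lra)) as [u' [Hu' Hd]].
  change (norm (minus u' u) < eps / 4) in Hd.
  destruct (exponential_formula_dom u' L (eps / 2) Hu' HL ltac:(lra)) as [d [Pd Hexp]].
  exists d; split; [exact Pd|]; intros h B j Hh HB Hj.
  assert (Pj : 0 <= INR j * h).
  { apply Rmult_le_pos; [apply pos_INR | lra]. }
  assert (K := Hexp h B j Hh HB Hj).
  replace (minus (Nat.iter j B u) (T (INR j * h) u)) with
    (plus (minus (Nat.iter j B u') (T (INR j * h) u'))
          (minus (T (INR j * h) (minus u' u)) (Nat.iter j B (minus u' u)))).
  - eapply Rle_trans; [apply (norm_triangle (V := H))|].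
    assert (K1 := norm_minus_le _ (T (INR j * h) (minus u' u))
                    (Nat.iter j B (minus u' u))).
    assert (K2 := T_contraction (INR j * h) (minus u' u) Pj).
    assert (K3 := iter_contraction H B
      (backward_euler_contraction H A alpha alpha_range A_sector h B ltac:(lra) HB)
      j (minus u' u)).
    lra.
  - rewrite T_minus by exact Pj.
    rewrite (iter_minus H B (be_plus _ _ _ HB) (be_scal _ _ _ HB)); vec_ring.
Qed.
End Euler.

(** * Products of series *)

Lemma sum_n_triangle (H : HilbertSpace) (a : nat -> R) (x : nat -> H) (n : nat) :
  sum_n (fun k => sum_n (fun i => scal (RtoC (a (k - i)%nat)) (x i)) k) n =
  sum_n (fun i => scal (RtoC (sum_n a (n - i))) (x i)) n.
Proof.
  induction n as [|n IH].
  - rewrite !sum_O; simpl; rewrite ?sum_O; reflexivity.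
  - rewrite sum_Sn, IH, !(sum_Sn _ n), Nat.sub_diag, sum_O.
    rewrite (sum_n_ext_loc (fun i => scal (RtoC (sum_n a (S n - i))) (x i))
      (fun i => plus (scal (RtoC (sum_n a (n - i))) (x i))
                     (scal (RtoC (a (S n - i)%nat)) (x i)))).
    + rewrite sum_n_plus; apply plus_assoc.
    + intros i Hi; replace (S n - i)%nat with (S (n - i)) by lia.
      rewrite sum_Sn; change (@plus R_AbelianMonoid) with Rplus; vec_ring.
Qed.

Lemma sum_n_triangle_R (a b : nat -> R) (n : nat) :
  sum_n (fun k => sum_n (fun i => a (k - i)%nat * b i) k) n =
  sum_n (fun i => sum_n a (n - i) * b i) n.
Proof.
  induction n as [|n IH].
  - rewrite !sum_O; simpl; rewrite ?sum_O; reflexivity.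
  - rewrite sum_Sn, IH, !(sum_Sn _ n), Nat.sub_diag, sum_O.
    rewrite (sum_n_ext_loc (fun i => sum_n a (S n - i) * b i)
      (fun i => plus (sum_n a (n - i) * b i) (a (S n - i)%nat * b i))).
    + rewrite sum_n_plus; apply plus_assoc.
    + intros i Hi; replace (S n - i)%nat with (S (n - i)) by lia.
      rewrite sum_Sn; apply Rmult_plus_distr_r.
Qed.

Lemma sum_n_opp (G : AbelianGroup) (f : nat -> G) (n : nat) :
  sum_n (fun k => opp (f k)) n = opp (sum_n f n).
Proof.
  induction n as [|n IH]; [rewrite !sum_O; reflexivity|].
  rewrite !sum_Sn, IH, opp_plus; reflexivity.
Qed.

Lemma sum_n_scal_minus (H : HilbertSpace) (c : C) (f g : nat -> H) (n : nat) :
  sum_n (fun i => scal c (minus (f i) (g i))) n =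
  scal c (minus (sum_n f n) (sum_n g n)).
Proof.
  induction n as [|n IH]; [rewrite !sum_O; reflexivity|].
  rewrite !sum_Sn, IH; vec_ring.
Qed.

Lemma sum_n_le_sum (f : nat -> R) (l : R) (n : nat) :
  (forall k, 0 <= f k) -> is_series f l -> sum_n f n <= l.
Proof.
  intros Hf Hl.
  apply (is_lim_seq_incr_compare (sum_n f) l Hl); intros k.
  rewrite sum_Sn; assert (0 <= f (S k)) by apply Hf.
  change (@plus R_AbelianMonoid) with Rplus; lra.
Qed.

(** The series of [b + a] and [b - a] have nonnegative terms, so their partial
    sums stay below their sums. *)
Lemma series_tail_le (a b : nat -> R) (la lb : R) (n : nat) :
  (forall k, Rabs (a k) <= b k) -> is_series a la -> is_series b lb ->
  Rabs (sum_n a n - la) <= lb - sum_n b n.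
Proof.
  intros Hab Ha Hb.
  apply Rabs_le_between'; apply and_comm; split.
  - assert (K : is_series (fun k => plus (b k) (a k)) (lb + la))
      by (apply (is_series_plus (V := R_NormedModule)); assumption).
    apply (sum_n_le_sum _ _ n) in K.
    + rewrite sum_n_plus in K; change (sum_n b n + sum_n a n <= lb + la) in K; lra.
    + intros k; assert (X := Hab k); apply Rabs_le_between in X.
      change (0 <= b k + a k); lra.
  - assert (K : is_series (fun k => plus (b k) (opp (a k))) (lb + - la)).
    { apply (is_series_plus (V := R_NormedModule)); [assumption|].
      apply (is_series_opp (V := R_NormedModule)); assumption. }
    apply (sum_n_le_sum _ _ n) in K.
    + rewrite sum_n_plus, (sum_n_opp R_AbelianGroup a) in K.
      change (sum_n b n + - sum_n a n <= lb + - la) in K; lra.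
    + intros k; assert (X := Hab k); apply Rabs_le_between in X.
      change (0 <= b k + - a k); lra.
Qed.

(** Mertens' theorem for a scalar series times a vector series. The defect
    between the partial sums of the product series and [la] times the partial
    sums of [x] is dominated by the same defect for the majorants, where the
    real theorem applies. *)
Lemma mertens (H : HilbertSpace) (a b p : nat -> R) (x : nat -> H)
    (la lb lp : R) (lx : H) :
  (forall k, Rabs (a k) <= b k) -> (forall k, norm (x k) <= p k) ->
  is_series a la -> is_series b lb -> is_series p lp -> is_series x lx ->
  is_series (fun k => sum_n (fun i => scal (RtoC (a (k - i)%nat)) (x i)) k)
    (scal (RtoC la) lx).
Proof.
  intros Hab Hxp Ha Hb Hp Hx.
  assert (Pb : forall k, 0 <= b k)
    by (intros k; eapply Rle_trans, Hab; apply Rabs_pos).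
  assert (Pp : forall k, 0 <= p k)
    by (intros k; eapply Rle_trans, Hxp; apply norm_ge_0).
  assert (D : is_lim_seq (fun n => lb * sum_n p n
                - sum_n (fun i => sum_n b (n - i) * p i) n) 0).
  { replace (Finite 0) with (Rbar_minus (lb * lp) (lb * lp))
      by (simpl; f_equal; ring).
    apply is_lim_seq_minus'.
    - apply (is_lim_seq_scal_l (sum_n p) lb lp), Hp.
    - assert (K := is_series_mult_pos p b lp lb Hp Hb Pp Pb).
      eapply is_lim_seq_ext; [|rewrite Rmult_comm; exact K].
      intros n; rewrite <- sum_n_triangle_R; apply sum_n_ext; intros k.
      rewrite <- sum_n_Reals; apply sum_n_ext; intros i; apply Rmult_comm. }
  assert (Z : filterlim (fun n => minus
      (sum_n (fun k => sum_n (fun i => scal (RtoC (a (k - i)%nat)) (x i)) k) n)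
      (scal (RtoC la) (sum_n x n))) eventually (locally (zero : H))).
  { apply (filterlim_norm_zero (V := H)).
    apply (is_lim_seq_le_le (fun _ => 0) _ _ 0) with (3 := D);
      [|apply is_lim_seq_const].
    intros n; split; [apply norm_ge_0|].
    rewrite sum_n_triangle.
    replace (minus _ (scal (RtoC la) (sum_n x n))) with
      (sum_n (fun i => scal (RtoC (sum_n a (n - i) - la)) (x i)) n).
    - eapply Rle_trans.
      + apply norm_sum_n_le with
          (b := fun i => plus (lb * p i) (opp (sum_n b (n - i) * p i))).
        intros i _; eapply Rle_trans; [apply norm_scal_C|].
        rewrite Cmod_R.
        assert (K := series_tail_le a b la lb (n - i) Hab Ha Hb).
        assert (0 <= norm (x i)) by apply norm_ge_0.
        change (Rabs (sum_n a (n - i) - la) * norm (x i)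
                <= lb * p i + - (sum_n b (n - i) * p i)).
        apply Rle_trans with ((lb - sum_n b (n - i)) * p i); [|lra].
        apply Rmult_le_compat; [apply Rabs_pos | assumption | exact K | apply Hxp].
      + apply Req_le; rewrite sum_n_plus; apply (f_equal2 Rplus);
          [apply (sum_n_mult_l (K := R_Ring)) | apply (sum_n_opp R_AbelianGroup)].
    - rewrite <- (sum_n_scal_l (V := H)).
      rewrite (sum_n_ext _ (fun i => plus (scal (RtoC (sum_n a (n - i))) (x i))
                 (opp (scal (RtoC la) (x i))))) by (intros; vec_ring).
      rewrite sum_n_plus; apply (f_equal (plus _)); apply (sum_n_opp H). }
  assert (W : filterlim (fun n => scal (RtoC la) (sum_n x n)) eventually
                (locally (scal (RtoC la) lx))).
  { eapply filterlim_comp; [exact Hx | apply (filterlim_scal_r (V := H))]. }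
  assert (Y := filterlim_comp_2 _ _ plus Z W (filterlim_plus (V := H) _ _)).
  rewrite plus_zero_l in Y.
  eapply filterlim_ext; [|exact Y]; intros n.
  assert (E : forall y z : H, plus (minus y z) z = y) by (intros; vec_ring).
  apply E.
Qed.

(** * The exponential of [a (Q - 1)] as a Poisson average of powers of [Q] *)

Definition exp_term (a : R) (k : nat) : R := a ^ k / INR (fact k).

Lemma exp_term_S a k : INR (S k) * exp_term a (S k) = a * exp_term a k.
Proof.
  unfold exp_term; rewrite fact_simpl, mult_INR; simpl (a ^ S k).
  field; split; [apply INR_fact_neq_0 | apply not_0_INR; lia].
Qed.

Lemma exp_term_pos a k : 0 <= a -> 0 <= exp_term a k.
Proof.
  intros Ha; apply Rdiv_le_0_compat; [apply pow_le, Ha | apply INR_fact_lt_0].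
Qed.

Lemma is_series_exp a : is_series (exp_term a) (exp a).
Proof.
  eapply is_series_ext; [|apply (is_exp_Reals a)].
  intros k; apply (f_equal (fun y => y * / INR (fact k)) (pow_n_pow a k)).
Qed.

(** Absorbing the factor [k] into [a^k/k!] shifts the index by one; each use of
    this raises the order of the computed moment by one. *)
Lemma is_series_size_bias (a l : R) (g : nat -> R) :
  is_series (fun k => g (S k) * exp_term a k) l ->
  is_series (fun k => INR k * g k * exp_term a k) (a * l).
Proof.
  intros Hg; apply (is_series_decr_1 (V := R_NormedModule)).
  replace (plus (a * l) _) with (a * l)
    by (change (a * l = a * l + - (0 * g 0%nat * exp_term a 0)); ring).
  eapply is_series_ext; [|apply (is_series_scal_l a _ _ Hg)].
  intros k; change (a * (g (S k) * exp_term a k)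
                    = INR (S k) * g (S k) * exp_term a (S k)).
  rewrite (Rmult_comm (INR (S k))), (Rmult_assoc (g (S k))), exp_term_S; ring.
Qed.

Definition poisson (a : R) (k : nat) : R := exp (- a) * exp_term a k.

Lemma poisson_pos a k : 0 <= a -> 0 <= poisson a k.
Proof.
  intros Ha; apply Rmult_le_pos; [apply Rlt_le, exp_pos | apply exp_term_pos, Ha].
Qed.

Lemma is_series_poisson_of (a l : R) (g : nat -> R) :
  is_series (fun k => g k * exp_term a k) (l * exp a) ->
  is_series (fun k => poisson a k * g k) l.
Proof.
  intros Hg.
  replace l with (exp (- a) * (l * exp a)).
  - eapply is_series_ext; [|apply (is_series_scal_l (exp (- a)) _ _ Hg)].
    intros k; change (exp (- a) * (g k * exp_term a k) = poisson a k * g k).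
    unfold poisson; ring.
  - rewrite exp_Ropp; field; apply Rgt_not_eq, exp_pos.
Qed.

Lemma poisson_total a : is_series (poisson a) 1.
Proof.
  apply (is_series_ext (fun k => poisson a k * 1)); [intros; apply Rmult_1_r|].
  apply is_series_poisson_of; rewrite Rmult_1_l.
  eapply is_series_ext; [|apply is_series_exp].
  intros k; symmetry; apply Rmult_1_l.
Qed.

Lemma exp_term_first_moment a :
  is_series (fun k => INR k * exp_term a k) (a * exp a).
Proof.
  eapply is_series_ext; [|apply (is_series_size_bias a (exp a) (fun _ => 1))].
  - intros k; change (INR k * 1 * exp_term a k = INR k * exp_term a k); ring.
  - eapply is_series_ext; [|apply is_series_exp].
    intros k; symmetry; apply Rmult_1_l.
Qed.

Lemma exp_term_second_moment a :
  is_series (fun k => INR k * INR k * exp_term a k) (a * ((a + 1) * exp a)).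
Proof.
  apply is_series_size_bias.
  replace ((a + 1) * exp a) with (plus (a * exp a) (exp a))
    by (change (a * exp a + exp a = (a + 1) * exp a); ring).
  eapply is_series_ext; [|apply (is_series_plus (V := R_NormedModule));
    [apply exp_term_first_moment | apply is_series_exp]].
  intros k; change (INR k * exp_term a k + exp_term a k = INR (S k) * exp_term a k).
  rewrite S_INR; ring.
Qed.

Lemma poisson_centered_mean a :
  is_series (fun k => poisson a k * (INR k - a)) 0.
Proof.
  apply is_series_poisson_of.
  replace (0 * exp a) with (plus (a * exp a) (scal (- a) (exp a)))
    by (change (a * exp a + - a * exp a = 0 * exp a); ring).
  eapply is_series_ext; [|apply (is_series_plus (V := R_NormedModule));
    [apply exp_term_first_moment |
     apply (is_series_scal_l (V := R_NormedModule)), is_series_exp]].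
  intros k; change (INR k * exp_term a k + - a * exp_term a k
                    = (INR k - a) * exp_term a k); ring.
Qed.

Lemma poisson_variance a :
  is_series (fun k => poisson a k * (INR k - a) ^ 2) a.
Proof.
  apply is_series_poisson_of.
  replace (a * exp a) with
    (plus (plus (a * ((a + 1) * exp a)) (scal (- 2 * a) (a * exp a)))
          (scal (a ^ 2) (exp a)))
    by (change (a * ((a + 1) * exp a) + - 2 * a * (a * exp a) + a ^ 2 * exp a
                = a * exp a); ring).
  eapply is_series_ext; [|apply (is_series_plus (V := R_NormedModule));
    [apply (is_series_plus (V := R_NormedModule));
      [apply exp_term_second_moment |
       apply (is_series_scal_l (V := R_NormedModule)), exp_term_first_moment] |
     apply (is_series_scal_l (V := R_NormedModule)), is_series_exp]].
  intros k; change (INR k * INR k * exp_term a k + - 2 * a * (INR k * exp_term a k)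
    + a ^ 2 * exp_term a k = (INR k - a) ^ 2 * exp_term a k); ring.
Qed.

Lemma sum_n_head (G : AbelianMonoid) (f : nat -> G) (n : nat) :
  sum_n f (S n) = plus (f 0%nat) (sum_n (fun k => f (S k)) n).
Proof.
  induction n as [|n IH].
  - rewrite sum_Sn, !sum_O; reflexivity.
  - rewrite sum_Sn, IH, (sum_Sn _ n); symmetry; apply plus_assoc.
Qed.

Section PoissonAverage.
Variable H : HilbertSpace.
Variable Q : H -> H.
Hypothesis Q_plus : forall u v, Q (plus u v) = plus (Q u) (Q v).
Hypothesis Q_scal : forall (k : C) u, Q (scal k u) = scal k (Q u).
Hypothesis Q_contraction : forall u, norm (Q u) <= norm u.
Variable a : R.
Hypothesis a_pos : 0 <= a.
Variable u : H.

Let B (v : H) : H := scal (RtoC (- a)) (minus v (Q v)).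
Let x (i : nat) : H := scal (RtoC (exp_term a i)) (Nat.iter i Q u).
Let b (k : nat) : H := sum_n (fun i => scal (RtoC (exp_term (- a) (k - i))) (x i)) k.

Lemma sum_n_map (f : nat -> H) n : Q (sum_n f n) = sum_n (fun k => Q (f k)) n.
Proof.
  induction n as [|n IH]; [rewrite !sum_O; reflexivity|].
  rewrite !sum_Sn, Q_plus, IH; reflexivity.
Qed.

(** The Cauchy product [b] of [exp (-a)] and [exp (a Q) u] obeys the recursion
    [(k+1) b_(k+1) = B b_k] that characterises the terms of [exp B u]. *)
Lemma cauchy_product_recursion k : scal (RtoC (INR (S k))) (b (S k)) = B (b k).
Proof.
  assert (Hx : forall i, scal (RtoC (INR (S i))) (x (S i)) = scal (RtoC a) (Q (x i))).
  { intros i; unfold x; rewrite Q_scal, Nat.iter_succ.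
    transitivity (scal (RtoC (INR (S i) * exp_term a (S i))) (Q (Nat.iter i Q u))).
    - vec_ring.
    - rewrite exp_term_S; vec_ring. }
  transitivity (plus
    (sum_n (fun i => scal (RtoC ((INR (S k) - INR i) * exp_term (- a) (S k - i))) (x i)) (S k))
    (sum_n (fun i => scal (RtoC (exp_term (- a) (S k - i))) (scal (RtoC (INR i)) (x i))) (S k))).
  { unfold b; rewrite <- (sum_n_scal_l (V := H)), <- sum_n_plus.
    apply sum_n_ext; intros i; vec_ring. }
  rewrite sum_Sn, (sum_n_head _ _ k).
  transitivity (plus
    (sum_n (fun i => scal (RtoC (- a * exp_term (- a) (k - i))) (x i)) k)
    (sum_n (fun i => scal (RtoC (a * exp_term (- a) (k - i))) (Q (x i))) k)).
  - match goal with |- plus (plus ?s1 ?z1) (plus ?z2 ?s2) = plus ?r1 ?r2 =>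
      assert (E1 : s1 = r1); [|assert (E2 : s2 = r2)] end.
    + apply sum_n_ext_loc; intros i Hi; f_equal; f_equal.
      replace (S k - i)%nat with (S (k - i)) by lia.
      rewrite <- exp_term_S, <- minus_INR by lia.
      replace (S k - i)%nat with (S (k - i)) by lia; reflexivity.
    + apply sum_n_ext; intros i; rewrite Hx.
      replace (S k - S i)%nat with (k - i)%nat by lia; vec_ring.
    + rewrite E1, E2, Rminus_diag, Rmult_0_l; cbn [INR]; vec_ring.
  - unfold b, B; rewrite sum_n_map.
    rewrite (sum_n_ext (fun i => Q (scal _ (x i)))
      (fun i => scal (RtoC (exp_term (- a) (k - i))) (Q (x i))))
      by (intros; apply Q_scal).
    rewrite <- sum_n_scal_minus, <- sum_n_plus.
    apply sum_n_ext; intros i; vec_ring.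
Qed.

Lemma exp_op_term k : scal (RtoC (/ INR (fact k))) (Nat.iter k B u) = b k.
Proof.
  induction k as [|k IH].
  - unfold b; rewrite sum_O; unfold x, exp_term; simpl.
    change (Nat.iter 0 B u) with u; replace (1 / 1) with (/ 1) by lra.
    rewrite Rinv_1; vec_ring.
  - rewrite Nat.iter_succ.
    assert (Bs : forall (r : R) v, B (scal (RtoC r) v) = scal (RtoC r) (B v)).
    { intros r v; unfold B; rewrite Q_scal; vec_ring. }
    assert (Pk : INR (S k) <> 0) by (apply not_0_INR; lia).
    transitivity (scal (RtoC (/ INR (S k))) (scal (RtoC (INR (S k))) (b (S k)))).
    + rewrite cauchy_product_recursion, <- IH, Bs.
      rewrite fact_simpl, mult_INR, Rinv_mult; vec_ring.
    + transitivity (scal (RtoC (/ INR (S k) * INR (S k))) (b (S k))).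
      * vec_ring.
      * rewrite Rinv_l by exact Pk; vec_ring.
Qed.

(** Both series are summed separately by comparison with the scalar exponential
    and multiplied by [mertens]. *)
Lemma exp_op_poisson_average :
  is_series (fun k => scal (RtoC (poisson a k)) (Nat.iter k Q u)) (exp_op B u).
Proof.
  assert (Hxp : forall k, norm (x k) <= exp_term a k * norm u).
  { intros k; unfold x; rewrite norm_scal_R by apply exp_term_pos, a_pos.
    apply Rmult_le_compat_l; [apply exp_term_pos, a_pos|].
    apply iter_contraction, Q_contraction. }
  assert (Sp : is_series (fun k => exp_term a k * norm u) (exp a * norm u)).
  { apply (is_series_scal_r (norm u)), is_series_exp. }
  destruct (ex_series_le (V := H) x _ Hxp (ex_intro _ _ Sp)) as [lx Hlx].
  assert (M : is_series b (scal (RtoC (exp (- a))) lx)).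
  { apply (mertens H (exp_term (- a)) (exp_term a) (fun k => exp_term a k * norm u)
      x (exp (- a)) (exp a) (exp a * norm u)); auto using is_series_exp.
    intros k; unfold exp_term, Rdiv; rewrite Rabs_mult, <- RPow_abs, Rabs_Ropp.
    rewrite (Rabs_pos_eq a), Rabs_pos_eq; [apply Rle_refl| |exact a_pos].
    apply Rlt_le, Rinv_0_lt_compat, INR_fact_lt_0. }
  replace (exp_op B u) with (scal (RtoC (exp (- a))) lx).
  - eapply is_series_ext; [|apply (is_series_scal_l (V := H)), Hlx].
    intros k; unfold x, poisson; vec_ring.
  - symmetry; apply (iota_filterlim_locally (V := H) (F := eventually)).
    eapply filterlim_ext; [|exact M].
    intros n; apply sum_n_ext; intros k; symmetry; apply exp_op_term.
Qed.
End PoissonAverage.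

(** * The rate of convergence *)

Lemma sum_n_RtoC (f : nat -> R) (n : nat) :
  sum_n (G := C_AbelianMonoid) (fun k => RtoC (f k)) n = RtoC (sum_n f n).
Proof.
  induction n as [|n IH]; [rewrite !sum_O; reflexivity|].
  rewrite !sum_Sn, IH; symmetry; apply RtoC_plus.
Qed.

Lemma is_series_scal_vector (H : HilbertSpace) (v : H) (q : nat -> R) (l : R) :
  is_series q l -> is_series (fun k => scal (RtoC (q k)) v) (scal (RtoC l) v).
Proof.
  intros Hq.
  apply (filterlim_ext (fun K => scal (RtoC (sum_n q K)) v)).
  { intros K; rewrite <- sum_n_RtoC, <- sum_n_scal_r; reflexivity. }
  apply (filterlim_comp nat C H (fun K => RtoC (sum_n q K)) (fun c => scal c v)
    eventually (@locally (AbsRing_UniformSpace C_AbsRing) (RtoC l))).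
  - apply (filterlim_locally (U := AbsRing_UniformSpace C_AbsRing)); intros eps.
    assert (K := proj1 (filterlim_locally (F := eventually) _ _) Hq eps).
    apply (filter_imp _ _) with (2 := K); intros n Hn.
    change (Cmod (Cminus (RtoC (sum_n q n)) (RtoC l)) < eps).
    rewrite <- RtoC_minus, Cmod_R; exact Hn.
  - apply (filterlim_scal_l (V := H)).
Qed.

Lemma le_epsilon_mult (x y c : R) :
  0 <= c -> (forall eps, 0 < eps -> x <= y + eps * c) -> x <= y.
Proof.
  intros Hc Hx; apply le_epsilon; intros eps Heps.
  assert (K := Hx (eps / (c + 1)) ltac:(apply Rdiv_lt_0_compat; lra)).
  assert (eps / (c + 1) * c <= eps); [|lra].
  replace eps with (eps / (c + 1) * (c + 1)) at 2 by (field; lra).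
  apply Rmult_le_compat_l; [apply Rlt_le, Rdiv_lt_0_compat|]; lra.
Qed.

(** Here [y k] is a limit of vectors with a Taylor expansion of second order
    around [k = n]. The vector [D] of the linear term may vary with the
    approximation, so no limit of it is ever needed: only its norm enters,
    multiplied by the weighted sum of [k - n], which for Poisson weights of mean
    [n] vanishes in the limit of large [K]. *)
Lemma weighted_taylor_sum (H : HilbertSpace) (q : nat -> R) (y : nat -> H)
    (n K : nat) (M1 M2 : R) :
  (forall k, 0 <= q k) ->
  (forall eps, 0 < eps -> exists (r : nat -> H) (D : H),
     norm D <= M1 /\
     (forall k, (k <= K)%nat -> norm (minus (y k) (r k)) <= eps) /\
     norm (minus (y n) (r n)) <= eps /\
     (forall k, norm (minus (minus (r k) (r n)) (scal (RtoC (INR k - INR n)) D))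
                <= M2 * (INR k - INR n) ^ 2)) ->
  norm (sum_n (fun k => scal (RtoC (q k)) (minus (y k) (y n))) K) <=
  M2 * sum_n (fun k => q k * (INR k - INR n) ^ 2) K
  + Rabs (sum_n (fun k => q k * (INR k - INR n)) K) * M1.
Proof.
  intros Hq Happ.
  assert (Sq : 0 <= sum_n q K).
  { clear - Hq; induction K as [|K IH]; [rewrite sum_O; apply Hq|].
    rewrite sum_Sn; apply Rplus_le_le_0_compat; [exact IH | apply Hq]. }
  apply le_epsilon_mult with (2 * sum_n q K); [lra|]; intros eps Heps.
  destruct (Happ eps Heps) as [r [D [HD [Hr [Hrn HT]]]]].
  set (E := fun k => plus (minus (minus (r k) (r n)) (scal (RtoC (INR k - INR n)) D))
                     (minus (minus (y k) (r k)) (minus (y n) (r n)))).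
  assert (S1 : sum_n (fun k => scal (RtoC (q k)) (minus (y k) (y n))) K =
    plus (sum_n (fun k => scal (RtoC (q k)) (E k)) K)
         (scal (RtoC (sum_n (fun k => q k * (INR k - INR n)) K)) D)).
  { rewrite <- sum_n_RtoC, <- sum_n_scal_r, <- sum_n_plus.
    apply sum_n_ext; intros k; unfold E; vec_ring. }
  rewrite S1.
  eapply Rle_trans; [apply (norm_triangle (V := H))|].
  assert (B1 : norm (scal (RtoC (sum_n (fun k => q k * (INR k - INR n)) K)) D)
    <= Rabs (sum_n (fun k => q k * (INR k - INR n)) K) * M1).
  { eapply Rle_trans; [apply norm_scal_C|]; rewrite Cmod_R.
    apply Rmult_le_compat_l; [apply Rabs_pos | exact HD]. }
  assert (B2 : norm (sum_n (fun k => scal (RtoC (q k)) (E k)) K)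
    <= sum_n (fun k => M2 * (q k * (INR k - INR n) ^ 2) + 2 * eps * q k) K).
  { apply norm_sum_n_le; intros k Hk; rewrite norm_scal_R by apply Hq.
    assert (norm (E k) <= M2 * (INR k - INR n) ^ 2 + 2 * eps).
    { unfold E; eapply Rle_trans; [apply (norm_triangle (V := H))|].
      assert (A1 := HT k); assert (A2 := Hr k Hk).
      assert (A3 := norm_minus_le _ (minus (y k) (r k)) (minus (y n) (r n))).
      lra. }
    apply Rle_trans with (q k * (M2 * (INR k - INR n) ^ 2 + 2 * eps)); [|lra].
    apply Rmult_le_compat_l; [apply Hq | assumption]. }
  assert (B3 : sum_n (fun k => M2 * (q k * (INR k - INR n) ^ 2) + 2 * eps * q k) K
    = M2 * sum_n (fun k => q k * (INR k - INR n) ^ 2) K + 2 * eps * sum_n q K).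
  { etransitivity; [apply (sum_n_plus (G := R_AbelianMonoid))|].
    apply (f_equal2 Rplus); apply (sum_n_mult_l (K := R_Ring)). }
  lra.
Qed.

Lemma norm_limit_le (H : HilbertSpace) (s : nat -> H) (l : H) (b : nat -> R) (lb : R) :
  filterlim s eventually (locally l) -> is_lim_seq b lb ->
  (forall n, norm (s n) <= b n) -> norm l <= lb.
Proof.
  intros Hs Hb Hsb.
  assert (K : is_lim_seq (fun n => norm (s n)) (norm l)).
  { eapply filterlim_comp; [exact Hs | apply (filterlim_norm (V := H))]. }
  apply (is_lim_seq_le _ _ _ _ Hsb K Hb).
Qed.

Section Rate.
Variable H : HilbertSpace.
Variable A : operator H.
Variable T : R -> H -> H.
Variable alpha : R.
Hypothesis alpha_range : 0 <= alpha < PI / 2.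
Hypothesis A_sectorial : m_sectorial A alpha.
Hypothesis T_gen : semigroup_generated_by A T.

(** The approximants are [B^(k m) u] with [B = (1 + h A)^-1] and [h = t/(n m)],
    so that step [k m] corresponds to time [k t/n]. *)
Lemma semigroup_taylor_approximation (t : R) (n K : nat) (u : H) (eps : R) :
  0 < t -> (1 <= n)%nat -> 0 < eps -> exists (r : nat -> H) (D : H),
    norm D <= norm u / cos alpha /\
    (forall k, (k <= K)%nat -> norm (minus (T (INR k * (t / INR n)) u) (r k)) <= eps) /\
    norm (minus (T (INR n * (t / INR n)) u) (r n)) <= eps /\
    (forall k, norm (minus (minus (r k) (r n)) (scal (RtoC (INR k - INR n)) D))
       <= 16 * norm u / (cos alpha ^ 2 * INR n ^ 2) * (INR k - INR n) ^ 2).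
Proof.
  intros Ht Hn Heps.
  destruct A_sectorial as [_ [Hdense [Hacc Hsec]]].
  assert (Hc := cos_alpha_range alpha alpha_range).
  assert (Pn : 1 <= INR n) by (apply (le_INR 1); lia).
  set (tau := t / INR n); assert (Ptau : 0 < tau) by (apply Rdiv_lt_0_compat; lra).
  destruct (exponential_formula H A T T_gen alpha alpha_range Hsec Hdense
              u (INR (K + n) * tau) eps) as [d [Pd Hexp]];
    [apply Rmult_le_pos; [apply pos_INR | lra] | exact Heps |].
  destruct (nfloor_ex (tau / d)) as [m0 [_ Hm0]].
  { apply Rlt_le, Rdiv_lt_0_compat; lra. }
  (* [m] is large enough for the step [h = tau/m] to be below [d]. *)
  set (m := S m0); assert (Pm : 1 <= INR m) by (apply (le_INR 1); unfold m; lia).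
  set (h := tau / INR m); assert (Ph : 0 < h) by (apply Rdiv_lt_0_compat; lra).
  assert (Hhd : h < d).
  { apply (Rlt_div_l tau) in Hm0; [|exact Pd].
    apply (Rlt_div_l tau); [lra|]; unfold m; rewrite S_INR; lra. }
  destruct (backward_euler_exists H A h Hacc Ph) as [B HB].
  assert (Htime : forall k, INR (k * m) * h = INR k * tau).
  { intros k; rewrite mult_INR; unfold h; field; lra. }
  assert (Happ : forall k, (k <= K + n)%nat ->
    norm (minus (T (INR k * tau) u) (Nat.iter (k * m) B u)) <= eps).
  { intros k Hk; rewrite norm_minus_sym, <- Htime.
    apply (Hexp h B (k * m)%nat (conj Ph Hhd) HB); rewrite Htime.
    apply Rmult_le_compat_r; [lra | apply le_INR, Hk]. }
  set (r := fun k => Nat.iter k B u).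
  exists (fun k => r (k * m)%nat), (scal (RtoC (INR m)) (fwd_diff r (n * m))).
  split; [|split; [|split]].
  - rewrite norm_scal_R by lra; apply (Rle_div_r _ (norm u)); [lra|].
    assert (Rt := ritt_estimate H B (be_plus _ _ _ HB) (be_scal _ _ _ HB)
      (cos alpha) (proj1 Hc)
      (backward_euler_pencil H A alpha alpha_range Hsec h B Ph HB) (n * m) u).
    unfold fwd_diff; rewrite norm_minus_sym.
    change (cos alpha * INR (S (n * m)) * norm (minus (r (n * m)%nat) (r (S (n * m))))
            <= norm u) in Rt.
    set (x := norm _) in *; assert (Px : 0 <= x) by apply norm_ge_0.
    rewrite S_INR, mult_INR in Rt.
    assert (INR m <= INR n * INR m + 1) by nra.
    assert (0 <= cos alpha * x) by (apply Rmult_le_pos; lra).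
    nra.
  - intros k Hk; apply Happ; lia.
  - apply Happ; lia.
  - intros k.
    assert (Ty := backward_euler_taylor H A alpha alpha_range Hsec h B Ph HB
      (k * m) (n * m) u ltac:(unfold m; nia)); cbv zeta in Ty; fold r in Ty.
    rewrite !mult_INR in Ty.
    replace (scal (RtoC (INR k - INR n)) (scal (RtoC (INR m)) (fwd_diff r (n * m))))
      with (scal (RtoC (INR k * INR m - INR n * INR m)) (fwd_diff r (n * m)))
      by vec_ring.
    eapply Rle_trans; [exact Ty|]; apply Req_le; field; lra.
Qed.

(** Only finitely many powers occur, so one step size [h] serves them all; the
    case [t = 0], where no [h > 0] is available, is trivial. *)
Lemma semigroup_poisson_partial_sum (t : R) (n K : nat) (u : H) :
  0 <= t -> (1 <= n)%nat ->
  norm (sum_n (fun k => scal (RtoC (poisson (INR n) k))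
     (minus (T (INR k * (t / INR n)) u) (T t u))) K) <=
  16 * norm u / (cos alpha ^ 2 * INR n ^ 2)
    * sum_n (fun k => poisson (INR n) k * (INR k - INR n) ^ 2) K
  + Rabs (sum_n (fun k => poisson (INR n) k * (INR k - INR n)) K)
    * (norm u / cos alpha).
Proof.
  intros Ht Hn.
  assert (Pn : 1 <= INR n) by (apply (le_INR 1); lia).
  assert (Hc := cos_alpha_range alpha alpha_range).
  assert (Pc : 0 < cos alpha ^ 2) by (apply pow_lt; lra).
  assert (Pu : 0 <= norm u) by apply norm_ge_0.
  replace (T t u) with (T (INR n * (t / INR n)) u) by (f_equal; field; lra).
  apply (weighted_taylor_sum H (poisson (INR n))
           (fun k => T (INR k * (t / INR n)) u) n).
  { intros k; apply poisson_pos; lra. }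
  intros eps Heps; destruct (Rle_lt_or_eq_dec 0 t Ht) as [Pt|<-].
  - apply semigroup_taylor_approximation; assumption.
  - assert (Z : forall k, T (INR k * (0 / INR n)) u = u).
    { intros k; replace (INR k * (0 / INR n)) with 0 by (field; lra).
      apply (sg_zero _ (proj1 T_gen)). }
    exists (fun _ => u), zero.
    rewrite norm_zero_H; split; [apply Rdiv_le_0_compat; lra|].
    split; [|split].
    + intros k _; rewrite Z, minus_eq_zero, norm_zero_H; lra.
    + rewrite Z, minus_eq_zero, norm_zero_H; lra.
    + intros k; match goal with |- norm ?x <= _ =>
        replace x with (zero : H) by vec_ring end.
      rewrite norm_zero_H; apply Rmult_le_pos; [|apply pow2_ge_0].
      apply Rdiv_le_0_compat; [lra|].
      apply Rmult_lt_0_compat; [exact Pc | apply pow_lt; lra].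
Qed.

Lemma exp_op_semigroup_estimate (t : R) (n : nat) (u : H) :
  0 <= t -> (1 <= n)%nat ->
  norm (minus
    (exp_op (fun v => scal (RtoC (- INR n)) (minus v (T (t / INR n) v))) u)
    (T t u)) <= 16 * norm u / (cos alpha ^ 2 * INR n).
Proof.
  intros Ht Hn.
  assert (Pn : 1 <= INR n) by (apply (le_INR 1); lia).
  assert (Ptau : 0 <= t / INR n) by (apply Rdiv_le_0_compat; lra).
  assert (Hc := cos_alpha_range alpha alpha_range).
  assert (PA := exp_op_poisson_average H (T (t / INR n))
    (fun u v => T_plus H A T T_gen _ u v Ptau)
    (fun k u => T_scal H A T T_gen _ k u Ptau)
    (fun u => T_contraction H A T T_gen _ u Ptau)
    (INR n) ltac:(lra) u).
  cbv zeta in PA; set (L := exp_op _ u) in *.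
  assert (PT : is_series (fun k => scal (RtoC (poisson (INR n) k)) (T t u)) (T t u)).
  { assert (K := is_series_scal_vector H (T t u) _ 1 (poisson_total (INR n))).
    replace (scal (RtoC 1) (T t u)) with (T t u) in K by vec_ring; exact K. }
  assert (PD := is_series_minus (V := H) _ _ _ _ PA PT).
  apply (norm_limit_le H _ _ (fun K => 16 * norm u / (cos alpha ^ 2 * INR n ^ 2)
      * sum_n (fun k => poisson (INR n) k * (INR k - INR n) ^ 2) K
      + Rabs (sum_n (fun k => poisson (INR n) k * (INR k - INR n)) K)
        * (norm u / cos alpha)) _ PD).
  - replace (Finite (16 * norm u / (cos alpha ^ 2 * INR n))) with
      (Finite (16 * norm u / (cos alpha ^ 2 * INR n ^ 2) * INR n
       + Rabs 0 * (norm u / cos alpha)))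
      by (f_equal; rewrite Rabs_R0; field; lra).
    apply is_lim_seq_plus'.
    + apply (is_lim_seq_scal_l _ _ (INR n)), (poisson_variance (INR n)).
    + apply (is_lim_seq_scal_r _ _ (Rabs 0)), (is_lim_seq_abs _ 0).
      apply (poisson_centered_mean (INR n)).
  - intros K; eapply Rle_trans; [|apply (semigroup_poisson_partial_sum t n K u Ht Hn)].
    apply Req_le; f_equal; apply sum_n_ext; intros k.
    rewrite (T_iter H A T T_gen) by exact Ptau; vec_ring.
Qed.
End Rate.

Theorem theorem5p1 :
  forall (H : HilbertSpace) (A : operator H) (alpha : R) (T : R -> H -> H),
    0 <= alpha < PI / 2 ->
    m_sectorial A alpha ->
    semigroup_generated_by A T ->
    exists N : R, 0 < N /\
      forall (t : R) (n : nat), 0 <= t -> (1 <= n)%nat ->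
        Rbar_le
          (opnorm (fun u : H =>
             minus
               (exp_op (fun v : H => scal (RtoC (- INR n)) (minus v (T (t / INR n) v))) u)
               (T t u)))
          (N / ((cos alpha) ^ 2 * INR n)).
Proof.
  intros H A alpha T Ha HA HT; exists 16; split; [lra|]; intros t n Ht Hn.
  apply (proj2 (Lub_Rbar_correct _)); intros x [u [Hu ->]].
  assert (Hc := cos_alpha_range alpha Ha).
  assert (Pn : 1 <= INR n) by (apply (le_INR 1); lia).
  assert (Pden : 0 < cos alpha ^ 2 * INR n).
  { apply Rmult_lt_0_compat; [apply pow_lt|]; lra. }
  eapply Rle_trans; [apply (exp_op_semigroup_estimate H A T alpha Ha HA HT); assumption|].
  apply Rmult_le_compat_r; [apply Rlt_le, Rinv_0_lt_compat, Pden | lra].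
Qed.
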